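(* Let $D$ be a countably infinite strongly connected solid tournament. Then $D$ has a Hamilton circle, i.e. there is a topological path $\alpha\colon[0,1]\to|D|$ with $\alpha(0)=\alpha(1)$ that is otherwise injective (injective on $[0,1)$) and that traverses every vertex of $D$.
   Context: Digraphs. A tournament is a digraph without loops in which any two distinct vertices are joined by exactly one directed edge. All paths in digraphs are directed. A digraph is strongly connected if every vertex can reach every other vertex by a finite directed path. A strong component is a maximal strongly connected subdigraph. $D$ is solid if $D-X$ has only finitely many strong components for every finite $X\subseteq V(D)$. Ends. A ray is a one-way infinite directed path that has a first vertex but no last vertex; its subrays are its tails. A ray in $D$ is solid in $D$ if for every finite $X\subseteq V(D)$ it has a tail in some strong component of $D-X$. Two solid rays are equivalent if for every finite $X\subseteq V(D)$ they have a tail in the same strong component of $D-X$. The equivalence classes are the ends of $D$; a ray in a class represents that end. $\Omega(D)$ is the set of ends. For an end $\omega$ and a finite $X\subseteq V(D)$, $C(X,\omega)$ is the strong component of $D-X$ in which every ray representing $\omega$ has a tail, and $\Omega(X,\omega)$ is the set of ends represented by a ray in $C(X,\omega)$. A finite $X$ separates ends $\omega,\eta$ if $C(X,\omega)\neq C(X,\eta)$. Limit edges. For distinct ends $\omega,\eta$, the pair $(\omega,\eta)$ is a limit edge from $\omega$ to $\eta$ if $D$ has an edge from $C(X,\omega)$ to $C(X,\eta)$ for every finite $X\subseteq V(D)$ separating $\omega$ and $\eta$. For a vertex $v$ and an end $\omega$, $(v,\omega)$ is a limit edge from $v$ to $\omega$ if $D$ has an edge from $v$ to $C(X,\omega)$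 for every finite $X\subseteq V(D)$ with $v\notin C(X,\omega)$; and $(\omega,v)$ is a limit edge from $\omega$ to $v$ if $D$ has an edge from $C(X,\omega)$ to $v$ for every finite $X\subseteq V(D)$ with $v\notin C(X,\omega)$. $\Lambda(D)$ is the set of limit edges. The space $|D|$. Its ground set is obtained from $V(D)\cup\Omega(D)$ and a copy $[0,1]_e$ of the unit interval for each $e\in E(D)\cup\Lambda(D)$ by identifying the tail of $e$ with $0\in[0,1]_e$ and the head of $e$ with $1\in[0,1]_e$. The topology is generated by the following basic open sets. (1) For a vertex $v$: for $\varepsilon>0$, the uniform star of radius $\varepsilon$ around $v$, i.e. $v$ together with an (open) $\varepsilon$ length, starting at $v$, of every edge or limit edge incident with $v$. (2) For an inner point of an edge $e\in E(D)$: open subintervals of $[0,1]_e$ containing it. (3) For an end $\omega$: for finite $X\subseteq V(D)$ and $\varepsilon>0$, the set $\hat C_\varepsilon(X,\omega)$, the union of $C(X,\omega)$ (with its edges), $\Omega(X,\omega)$, every limit edge with both endpoints in $C(X,\omega)\cup\Omega(X,\omega)$, and an (open) $\varepsilon$ length, at the endpoint lying in $C(X,\omega)\cup\Omega(X,\omega)$, of every edge or limit edge with precisely one endpoint in $C(X,\omega)\cup\Omega(X,\omega)$. (4) For an inner point $z$ of a limit edge $(\omega,\eta)$ between ends: for finite $X$ separating $\omega$ and $\eta$ and $\varepsilon>0$ small, the union of the open $\varepsilon$-intervals around the copy of $z$ in every edge or limit edge from $C(X,\omega)\cup\Omega(X,\omega)$ to $C(X,\eta)\cup\Omega(X,\eta)$.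 (5) For an inner point $z$ of a limit edge $(v,\omega)$ with $v$ a vertex: for finite $X$ containing $v$ and $\varepsilon>0$ small, the union of the open $\varepsilon$-intervals around the copy of $z$ in every edge or limit edge from $v$ to $C(X,\omega)\cup\Omega(X,\omega)$; analogously for limit edges $(\omega,v)$, using edges and limit edges from $C(X,\omega)\cup\Omega(X,\omega)$ to $v$. Topological paths. A topological path in $|D|$ is a continuous map $\alpha\colon[0,1]\to|D|$ that respects the direction of the edges and limit edges it traverses: whenever $s<t$ and $\alpha([s,t])\subseteq[0,1]_e$ for some $e\in E(D)\cup\Lambda(D)$, the coordinate of $\alpha(s)$ in $[0,1]_e$ is at most that of $\alpha(t)$. It is closed if $\alpha(0)=\alpha(1)$. A Hamilton circle of $D$ is a closed but otherwise injective topological path in $|D|$ that traverses every vertex of $D$. *)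

(* Defs.v *)
From HB Require Import structures.
From mathcomp Require Import all_boot all_order all_algebra.
From mathcomp Require Import all_classical all_reals all_analysis.

Set Implicit Arguments.
Unset Strict Implicit.
Unset Printing Implicit Defensive.

Import Order.TTheory GRing.Theory Num.Theory.
Import numFieldNormedType.Exports.

Local Open Scope classical_set_scope.
Local Open Scope ring_scope.

(* Digraphs without parallel edges: an edge is an ordered pair of vertices. *)
Record digraph := Digraph { vertex :> choiceType; edge : rel vertex }.

Definition tournament (D : digraph) : Prop :=
  (forall v : D, ~~ edge v v) /\
  (forall u v : D, u != v -> edge u v (+) edge v u).

Section Digraph.
Variable D : digraph.
Implicit Types (S X C : set D) (r s : nat -> D) (u v : D).

Definition dipath_in S u v : Prop :=
  exists p : seq D, [/\ path (@edge D) u p, uniq (u :: p), last u p = v &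
    forall w, w \in u :: p -> S w].

Definition strongly_connected S : Prop :=
  forall u v, S u -> S v -> dipath_in S u v.

(* Strong components of D - X.  Adding edges preserves strong connectedness,
   so a maximal strongly connected subdigraph is induced and is represented
   by its vertex set. *)
Definition strong_component X C : Prop :=
  [/\ C !=set0, C `<=` ~` X, strongly_connected C &
    forall C', C `<=` C' -> C' `<=` ~` X -> strongly_connected C' -> C' = C].

Definition solid : Prop :=
  forall X, finite_set X -> finite_set [set C | strong_component X C].

Definition ray r : Prop := injective r /\ forall n, edge (r n) (r n.+1).

Definition has_tail_in r C : Prop :=
  exists k, forall n, (k <= n)%N -> C (r n).

Definition solid_ray r : Prop :=
  ray r /\ forall X, finite_set X ->
    exists2 C, strong_component X C & has_tail_in r C.

Definition ray_equiv r s : Prop :=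
  forall X, finite_set X ->
    exists C, [/\ strong_component X C, has_tail_in r C & has_tail_in s C].

Definition ends : set (set (nat -> D)) :=
  [set w | exists2 r, solid_ray r &
    w = [set s | solid_ray s /\ ray_equiv r s]].

(* C(X, w); the default value [set0] is only taken for infinite [X]. *)
Definition end_comp X (w : ends) : set D :=
  xget set0 [set C | strong_component X C /\
                     forall r, val w r -> has_tail_in r C].

(* Omega(X, w) *)
Definition end_ends X (w : ends) : set ends :=
  [set h : ends | exists2 r, val h r & range r `<=` end_comp X w].

Definition separates X (w h : ends) : Prop :=
  finite_set X /\ end_comp X w <> end_comp X h.

Definition edge_between (A B : set D) : Prop :=
  exists u v, [/\ A u, B v & edge u v].

Definition limit_edge_ends (w h : ends) : Prop :=
  w <> h /\ forall X, separates X w h ->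
    edge_between (end_comp X w) (end_comp X h).

Definition limit_edge_to_end v (w : ends) : Prop :=
  forall X, finite_set X -> ~ end_comp X w v ->
    edge_between [set v] (end_comp X w).

Definition limit_edge_from_end (w : ends) v : Prop :=
  forall X, finite_set X -> ~ end_comp X w v ->
    edge_between (end_comp X w) [set v].

Definition node : Type := (vertex D + ends)%type.

Definition is_arc (p q : node) : Prop :=
  match p, q with
  | inl u, inl v => edge u v
  | inl v, inr w => limit_edge_to_end v w
  | inr w, inl v => limit_edge_from_end w v
  | inr w, inr h => limit_edge_ends w h
  end.

(* The elements of E(D) together with those of Lambda(D). *)
Record darc := DArc {
  arc_tail : node;
  arc_head : node;
  arcP : is_arc arc_tail arc_head }.

Definition is_edge (e : darc) : Prop :=
  exists u v, arc_tail e = inl u /\ arc_head e = inl v.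

(* C(X, w) together with Omega(X, w) *)
Definition end_nodes X (w : ends) : set node :=
  [set p | match p with
           | inl v => end_comp X w v
           | inr h => end_ends X w h
           end].

End Digraph.
Arguments ends : clear implicits.

(* The ground set of |D|.  Identifying the endpoints of every [0,1]_e with
   the tail and the head of e leaves V(D), Omega(D) and one copy of the open
   unit interval per arc; [arc_point e] is the resulting map [0,1]_e -> |D|. *)
Inductive end_space (R : realType) (D : digraph) : Type :=
| Node of node D
| Inner of darc D & {t : R | 0 < t < 1}.
Arguments Node {R D}.
Arguments Inner {R D}.

HB.instance Definition _ (R : realType) (D : digraph) :=
  gen_eqMixin (end_space R D).
HB.instance Definition _ (R : realType) (D : digraph) :=
  gen_choiceMixin (end_space R D).

Section Space.
Variables (R : realType) (D : digraph).
Implicit Types (X : set D) (eps z t : R) (v : D) (w h : ends D) (e : darc D).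

(* Meant for [t] in [0,1]. *)
Definition arc_point e t : end_space R D :=
  if insub t is Some t' then Inner e t'
  else if t <= 0 then Node (arc_tail e) else Node (arc_head e).

Definition star v eps : set (end_space R D) :=
  [set x | match x with
    | Node p => p = inl v
    | Inner e t => (arc_tail e = inl v /\ val t < eps) \/
                   (arc_head e = inl v /\ 1 - eps < val t)
    end].

Definition edge_interval e (a b : R) : set (end_space R D) :=
  [set x | if x is Inner f t then f = e /\ a < val t < b else False].

(* The set \hat C_eps(X, w) *)
Definition end_nbhd X w eps : set (end_space R D) :=
  [set x | match x with
    | Node p => end_nodes X w p
    | Inner e t =>
        [\/ end_nodes X w (arc_tail e) /\ end_nodes X w (arc_head e),
            [/\ end_nodes X w (arc_tail e), ~ end_nodes X w (arc_head e) &
                val t < eps]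
          | [/\ ~ end_nodes X w (arc_tail e), end_nodes X w (arc_head e) &
                1 - eps < val t]]
    end].

(* The open intervals of radius [eps] around the copies of [z] in all edges
   and limit edges from [A] to [B]. *)
Definition arcs_interval (A B : set (node D)) z eps : set (end_space R D) :=
  [set x | if x is Inner e t
           then [/\ A (arc_tail e), B (arc_head e) & `|val t - z| < eps]
           else False].

Definition small_at z eps : Prop := [/\ 0 < eps, 0 <= z - eps & z + eps <= 1].

Inductive basic_open : set (end_space R D) -> Prop :=
| basic_vertex v eps : 0 < eps -> basic_open (star v eps)
| basic_edge e a b : is_edge e -> 0 <= a -> a < b -> b <= 1 ->
    basic_open (edge_interval e a b)
| basic_end X w eps : finite_set X -> 0 < eps ->
    basic_open (end_nbhd X w eps)
| basic_limit_edge_ends X w h z eps :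
    limit_edge_ends w h -> separates X w h -> small_at z eps ->
    basic_open (arcs_interval (end_nodes X w) (end_nodes X h) z eps)
| basic_limit_edge_to_end X v w z eps :
    limit_edge_to_end v w -> finite_set X -> X v -> small_at z eps ->
    basic_open (arcs_interval [set inl v] (end_nodes X w) z eps)
| basic_limit_edge_from_end X w v z eps :
    limit_edge_from_end w v -> finite_set X -> X v -> small_at z eps ->
    basic_open (arcs_interval (end_nodes X w) [set inl v] z eps).

End Space.

HB.instance Definition _ (R : realType) (D : digraph) :=
  isSubBaseTopological.Build (end_space R D) (@basic_open R D) id.

Section Paths.
Variables (R : realType) (D : digraph).
Implicit Types alpha : R -> end_space R D.

(* Only the values of [alpha] on [0,1] matter.  The coordinate of a point of
   [0,1]_e is unique unless [e] is a loop. *)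
Definition topological_path alpha : Prop :=
  {within `[0, 1], continuous alpha} /\
  forall (s t : R) (e : darc D), 0 <= s -> s < t -> t <= 1 ->
    alpha @` `[s, t] `<=` arc_point e @` `[0, 1] ->
    forall a b : R, a \in `[0, 1] -> b \in `[0, 1] ->
      alpha s = arc_point e a -> alpha t = arc_point e b -> a <= b.

Definition hamilton_circle alpha : Prop :=
  [/\ topological_path alpha,
      alpha 0 = alpha 1,
      {in `[0, 1[ &, injective alpha} &
      forall v : D, exists2 t, t \in `[0, 1] & alpha t = Node (inl v)].

End Paths.

(* Main.v *)
Require Import Defs.
From mathcomp Require Import all_boot all_order all_algebra.
From mathcomp Require Import all_classical all_reals all_analysis.
From mathcomp Require Import zify lra.

(* The strong components of D - X are finitely many and linearly ordered, all
   edges between two of them going in the same direction.  A circle is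
   approximated by cyclic words whose letters are vertices and strong components
   of D - X, for growing finite X.  A component C between letters A and B can be
   resolved in place if, say, every terminal part of C has an edge to B: pick an
   out-neighbour x of A in C and replace C by x, K_1, ..., K_m, where K_1, ..., K_m
   are the components of C - x in their order; since C is strong, x has an edge
   to K_1, and each K_i inherits the property with respect to its right
   neighbour.  Doing this along a path from A through C resolves any prescribed
   vertex of C.  A first word is obtained from a minimal finite X for which D - X
   is not strong: a Hamilton path of X followed by the components of D - X.  If
   there is no such X, the word v, D - v works.  Laying the words out in [0,1],
   with nested intervals for the components, the limit visits each vertex and
   each end once, and the gaps between them are edges and limit edges. *)

Import Order.TTheory GRing.Theory Num.Theory.
Import numFieldNormedType.Exports.

Local Open Scope classical_set_scope.
Local Open Scope card_scope.

Set Implicit Arguments.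
Unset Strict Implicit.
Unset Printing Implicit Defensive.

(** * Strong components of tournaments *)

Section StrongConnection.
Variable D : digraph.
Implicit Types (S U K X Y C A B : set D) (u v x : D).

(** A bare edge from C to B need not survive a refinement: after the deletion of x it may start in a
    component of C - x other than the last, which leaves K_m without an edge to B. Firmness
    quantifies over all finite deletions at once and is therefore inherited. One firm side per
    letter is enough: on the other side a single edge suffices, because its end in C is taken as the
    vertex x. Two neighbouring letters that are both components are always fully joined, so nothing
    between them can be lost. Minimality of X makes D - (X - x) strong for every x in X; this
    supplies the two edges that join the path through X to the components. Refining a letter keeps
    both end points of its interval, so a gap between letters is never altered once it is there,
    while the letters beside it shrink. The edges between these letters are what makes the gap an
    edge or a limit edge. Interval lengths tend to 0, which leaves a single time for each end. *)

Definition out_closed S U : Prop :=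
  forall u v, U u -> S v -> edge u v -> U v.

(** For the converse, the set of vertices reached from [u] by walks inside [S] is closed, and
    [shortenP] turns a walk into a path. Most later arguments on strong connectedness use this form,
    which mentions no paths. *)
Lemma strongly_connectedP S :
  strongly_connected S <->
  forall U, U `<=` S -> U !=set0 -> out_closed S U -> S `<=` U.
Proof.
split=> [Ss U US [u Uu] Ucl v Sv | H u v Su Sv].
  have [p [+ _ + +]] := Ss u v (US _ Uu) Sv.
  elim: p u Uu => [|w p IH] u Uu /=; first by move=> _ <-.
  move=> /andP[uw wp] lv inS; apply: (IH w) => //.
    by apply: Ucl uw => //; apply: inS; rewrite !inE eqxx orbT.
  by move=> z zp; apply: inS; rewrite inE zp orbT.
pose U := [set w | S w /\ exists p : seq D,
  [/\ path (@edge D) u p, last u p = w & forall z, z \in u :: p -> S z]].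
have /(_ v Sv)[_ [p [pp pv pS]]] : S `<=` U.
  apply: H => [w []//| | w z [Sw [p [pp pw pS]]] Sz wz].
    by exists u; split=> //; exists [::]; split=> // z; rewrite inE => /eqP ->.
  split=> //; exists (rcons p z); rewrite rcons_path last_rcons pp pw wz.
  split=> // y; rewrite -rcons_cons mem_rcons inE => /orP[/eqP -> //|].
  exact: pS.
case: (shortenP pp) pv => q qp qu sub qv.
exists q; split=> // z; rewrite inE => /orP[/eqP -> //|/sub zp].
by apply: pS; rewrite inE zp orbT.
Qed.

Lemma out_closed_absorb S U A u : strongly_connected A -> A `<=` S ->
  out_closed S U -> A u -> U u -> A `<=` U.
Proof.
move=> /strongly_connectedP sA AS Ucl Au Uu z Az.
suff /(_ z Az)[] : A `<=` U `&` A by [].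
apply: sA; [by move=> y [] | by exists u | move=> a b [Ua Aa] Ab ab].
by split=> //; apply: Ucl ab => //; exact: AS.
Qed.

Lemma strongly_connected1 u : strongly_connected [set u].
Proof.
by apply/strongly_connectedP => U sU [v Uv] _ w ->; rewrite -(sU v Uv).
Qed.

Lemma strongly_connected_bigcup (F : set (set D)) u :
  (forall S, F S -> strongly_connected S /\ S u) ->
  strongly_connected (\bigcup_(S in F) S).
Proof.
move=> HF; apply/strongly_connectedP => U sU [v Uv] Ucl.
have sub S w : F S -> S w -> U w -> S `<=` U.
  move=> FS; have [sS _] := HF S FS.
  by apply: (out_closed_absorb sS _ Ucl) => z Sz; exists S.
have [S FS Sv] := sU v Uv.
have Uu : U u by apply: (sub S v) => //; have [] := HF S FS.
by move=> w [S' FS' S'w]; apply: (sub S' u) => //; have [] := HF S' FS'.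
Qed.

Lemma strongly_connectedU A B : strongly_connected A -> strongly_connected B ->
  edge_between A B -> edge_between B A -> strongly_connected (A `|` B).
Proof.
move=> sA sB [a [b [Aa Bb ab]]] [b' [a' [Bb' Aa' ba']]].
apply/strongly_connectedP => U sU [v Uv] Ucl.
have AU w := @out_closed_absorb _ U A w sA (@subsetUl _ A B) Ucl.
have BU w := @out_closed_absorb _ U B w sB (@subsetUr _ A B) Ucl.
have [Av|Bv] := sU v Uv.
  have Ub : U b by apply: Ucl ab; [exact: AU Uv _ _ | right].
  by move=> w [/(AU v Av Uv)|/(BU b Bb Ub)].
have Ua' : U a' by apply: Ucl ba'; [exact: BU Uv _ _ | left].
by move=> w [/(AU a' Aa' Ua')|/(BU v Bv Uv)].
Qed.

Lemma strongly_connectedU_meet A B u :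
  strongly_connected A -> strongly_connected B -> A u -> B u ->
  strongly_connected (A `|` B).
Proof.
move=> sA sB Au Bu.
rewrite (_ : A `|` B = \bigcup_(S in [set A; B]) S).
  by apply: (@strongly_connected_bigcup _ u) => S [] ->.
by rewrite bigcup_setU !bigcup_set1.
Qed.

Lemma comp_sub X C C' : strong_component X C -> C' `<=` ~` X ->
  strongly_connected C' -> C `&` C' !=set0 -> C' `<=` C.
Proof.
move=> [_ CX sC max] C'X sC' [u [Cu C'u]].
suff <- : C `|` C' = C by move=> v; right.
apply: max; first by move=> v; left.
  by move=> v [/CX|/C'X].
exact: strongly_connectedU_meet Cu C'u.
Qed.

Lemma comp_eq X C C' : strong_component X C -> strong_component X C' ->
  C `&` C' !=set0 -> C = C'.
Proof.
move=> hC hC' CC'; have [_ CX sC _] := hC; have [_ C'X sC' _] := hC'.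
apply/seteqP; split; last exact: comp_sub hC _ _ _.
by apply: comp_sub hC' _ _ _ => //; rewrite setIC.
Qed.

(** The union of all strongly connected sets outside [X] through one vertex [u] of [S] is itself
    strongly connected, hence it is the maximal one; no appeal to Zorn's lemma is made. *)
Lemma strong_sub_comp X S : S !=set0 -> S `<=` ~` X -> strongly_connected S ->
  exists2 C, strong_component X C & S `<=` C.
Proof.
move=> [u Su] SX sS.
pose F : set (set D) := [set C | [/\ strongly_connected C, C u & C `<=` ~` X]].
have FU : strongly_connected (\bigcup_(C in F) C).
  by apply: (@strongly_connected_bigcup _ u) => C [].
exists (\bigcup_(C in F) C); last by move=> v Sv; exists S.
split=> //; first by exists u, S.
  by move=> v [C [_ _ CX] Cv]; exact: CX.
move=> C' sub C'X sC'; apply/seteqP; split=> // v C'v.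
by exists C' => //; split=> //; apply: sub; exists S.
Qed.

Lemma comp_exists X u : ~ X u -> exists2 C, strong_component X C & C u.
Proof.
move=> Xu; have [| | |C hC uC] := @strong_sub_comp X [set u].
- by exists u.
- by move=> v ->.
- exact: strongly_connected1.
by exists C => //; apply: uC.
Qed.

Lemma comp_widen X Y C : strong_component X C -> X `<=` Y -> C `<=` ~` Y ->
  strong_component Y C.
Proof.
move=> [C0 _ sC max] XY CY; split=> // C' CC' C'Y sC'.
by apply: max => // v /C'Y Yv Xv; apply: Yv; apply: XY.
Qed.

Definition full A B : Prop := forall a b, A a -> B b -> edge a b.

Lemma full_subr A B B' : B' `<=` B -> full A B -> full A B'.
Proof. by move=> sB AB a b Aa /sB; exact: AB. Qed.

Lemma full_subl A A' B : A' `<=` A -> full A B -> full A' B.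
Proof. by move=> sA AB a b /sA Aa Bb; exact: AB. Qed.

Lemma full_edge_between A B : A !=set0 -> B !=set0 -> full A B ->
  edge_between A B.
Proof. by move=> [a Aa] [b Bb] AB; exists a, b; split=> //; exact: AB. Qed.

End StrongConnection.

(** * The linear order of the strong components of a tournament *)

Section Tournament.
Variables (D : digraph) (Dt : tournament D).
Implicit Types (S U K X Y C A B : set D) (u v x : D).

Lemma tournament_irr u : edge u u = false.
Proof. by have [/(_ u)/negbTE] := Dt. Qed.

Lemma tournament_total u v : u <> v -> ~ edge u v -> edge v u.
Proof.
move=> /eqP uv /negP/negbTE nuv.
by have [_ /(_ u v uv)] := Dt; rewrite nuv.
Qed.

Lemma tournament_asym u v : edge u v -> ~ edge v u.
Proof.
move=> uv vu; have [_ /(_ u v)] := Dt.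
rewrite uv vu => H; suff /H : u != v by [].
by apply: contraTneq uv => ->; rewrite tournament_irr.
Qed.

Lemma full_asym A B : A !=set0 -> B !=set0 -> full A B -> ~ full B A.
Proof.
by move=> [a Aa] [b Bb] AB BA; apply: (tournament_asym (AB a b Aa Bb)); exact: BA.
Qed.

Lemma not_edge_between_full A B : (forall v, A v -> ~ B v) ->
  ~ edge_between A B -> full B A.
Proof.
move=> dAB nAB b a Bb Aa; apply: tournament_total.
  by move=> ab; apply: (dAB a) => //; rewrite ab.
by move=> ab; apply: nAB; exists a, b.
Qed.

(** Edges in both directions would make the union strongly connected, against maximality. If one
    direction is missing, all pairs are joined in the other. *)
Lemma comp_full_total X K K' : strong_component X K -> strong_component X K' ->
  K <> K' -> full K K' \/ full K' K.
Proof.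
move=> hK hK' nKK'.
have dK v : K v -> ~ K' v.
  by move=> Kv K'v; apply: nKK'; apply: comp_eq hK hK' _; exists v.
have [KK'|/(not_edge_between_full dK)] := pselect (edge_between K K'); last by right.
have [K'K|/not_edge_between_full H] := pselect (edge_between K' K); last first.
  by left; apply: H => v K'v Kv; exact: dK Kv K'v.
have [K0 KX sK max] := hK; have [_ K'X sK' _] := hK'.
suff E : K `|` K' = K.
  case: KK' => a [b [_ K'b _]]; exfalso; apply: (dK b) => //.
  by rewrite -E; right.
apply: max; [by left | by move=> v [/KX|/K'X] | exact: strongly_connectedU].
Qed.

(** Otherwise either [K = K''], which contradicts asymmetry, or [K''] is full to [K] and the three
    components form a cyclic triple; the union of such a triple is strongly connected, against
    maximality. *)
Lemma comp_full_trans X K K' K'' : strong_component X K ->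
  strong_component X K' -> strong_component X K'' ->
  full K K' -> full K' K'' -> full K K''.
Proof.
move=> hK hK' hK'' KK' K'K''.
have [K0 KX sK max] := hK; have [K'0 K'X sK' _] := hK'.
have [K''0 K''X sK'' max''] := hK''.
have [E|/(comp_full_total hK hK'')[//|K''K]] := pselect (K = K'').
  by case: (full_asym K0 K'0 KK'); rewrite E.
suff E : K `|` K' `|` K'' = K''.
  case: (full_asym K'0 K''0 K'K''); rewrite -E.
  case: K'0 => k' K'k' a b K''a K'b.
  exfalso; have K''k' : K'' k' by rewrite -E; left; right.
  by have := tournament_irr k'; rewrite (K'K'' k' k').
apply: max''; [by right | by move=> v [[/KX|/K'X]|/K''X] | ].
apply/strongly_connectedP => U sU [v Uv] Ucl.
pose S := K `|` K' `|` K''.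
have next A B w : strongly_connected A -> A `<=` S -> B !=set0 -> B `<=` S ->
    full A B -> A w -> U w -> exists2 b, B b & U b.
  move=> sA AS [b Bb] BS AB Aw Uw; exists b => //.
  by apply: Ucl (AB w b Aw Bb) => //; exact: BS.
have [SK SK' SK''] : [/\ K `<=` S, K' `<=` S & K'' `<=` S].
  by split=> w; [left; left | left; right | right].
have absorb A w : strongly_connected A -> A `<=` S -> A w -> U w -> A `<=` U.
  by move=> sA AS; exact: out_closed_absorb sA AS Ucl.
have [a [Ka Ua]] : exists a, K a /\ U a.
  have [[Kv|K'v]|K''v] := sU v Uv; first by exists v.
    have [b K''b Ub] := next K' K'' v sK' SK' K''0 SK'' K'K'' K'v Uv.
    by have [a ? ?] := next K'' K b sK'' SK'' K0 SK K''K K''b Ub; exists a.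
  by have [a ? ?] := next K'' K v sK'' SK'' K0 SK K''K K''v Uv; exists a.
have [b K'b Ub] := next K K' a sK SK K'0 SK' KK' Ka Ua.
have [c K''c Uc] := next K' K'' b sK' SK' K''0 SK'' K'K'' K'b Ub.
move=> w [[|]|]; [exact: (absorb _ _ sK SK Ka Ua)
  | exact: (absorb _ _ sK' SK' K'b Ub) | exact: (absorb _ _ sK'' SK'' K''c Uc)].
Qed.

Lemma sorted_comps (X C : set D) : solid D -> finite_set X ->
  exists Ks : seq (set D), pairwise (fun A B => `[< full A B >]) Ks /\
    forall K, K \in Ks <-> strong_component X K /\ K `<=` C.
Proof.
move=> Ds fX.
have /finite_seqP[s sP] : finite_set [set K | strong_component X K /\ K `<=` C].
  by apply: sub_finite_set (Ds X fX) => K [].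
pose P := [pred K : set D | `[< strong_component X K >]].
(* Fullness is not reflexive, so equality is added to obtain a total relation for [sort]; since
   [undup s] has no repetitions, it is dropped again afterwards. *)
pose r := [rel A B : set D | (A == B) || `[< full A B >]].
have sX K : K \in s -> strong_component X K.
  by move=> Ks; have : [set` s] K by []; rewrite -sP => -[].
have Ps : all P (undup s) by apply/allP => K; rewrite mem_undup => /sX ?; exact/asboolP.
have rtot : {in P &, total r}.
  move=> A B /asboolP hA /asboolP hB /=; have [->//|/eqP nAB] := eqVneq A B.
  have [AB|BA] := comp_full_total hA hB nAB.
    by apply/orP; left; exact/asboolP.
  by apply/orP; right; apply/orP; right; exact/asboolP.
have rtr : {in P & &, transitive r}.
  move=> B A C' /asboolP hB /asboolP hA /asboolP hC /=.
  have [->//|_ /=] := eqVneq A B; move=> /asboolP AB.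
  have [<-|_ /=] := eqVneq B C'; first by move=> _; apply/orP; right; exact/asboolP.
  move=> /asboolP BC; apply/orP; right; apply/asboolP.
  exact: comp_full_trans hA hB hC AB BC.
have := sort_sorted_in rtot Ps.
have us := undup_uniq s; rewrite -(sort_uniq r) in us.
rewrite (sorted_pairwise_in rtr); last by rewrite all_sort.
move=> rs; exists (sort r (undup s)); split.
  move: us; rewrite uniq_pairwise => us.
  have := pairwise_relI (fun A B => A != B) r (sort r (undup s)).
  rewrite us rs /=; apply: sub_pairwise => A B /= /andP[/negbTE ->]; exact: id.
move=> K; rewrite mem_sort mem_undup; split.
  by move=> Ks; have : [set` s] K by []; rewrite -sP.
by move=> hK; have : [set` s] K by rewrite -sP.
Qed.

(** The other sets receive all edges from [K] and send none back. Without an edge from [x] into [K],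
    the set [S] minus [K] would therefore be closed under out-neighbours in [S]. *)
Lemma strong_edge_to_first S x K Ks : strongly_connected S -> S x -> ~ K x ->
  K !=set0 -> K `<=` S ->
  (forall v, S v -> v = x \/ exists2 K', K' \in K :: Ks & K' v) ->
  all (fun A => `[< full K A >]) Ks ->
  edge_between [set x] K.
Proof.
move=> /strongly_connectedP sS Sx Kx [k Kk] KS cov /allP fK; apply: contrapT => nxK.
suff /(_ k (KS k Kk))[] : S `<=` S `&` ~` K by [].
apply: sS => [v []//||u v [Su nKu] Sv uv]; first by exists x.
split=> // Kv; have [ux|[K']] := cov u Su.
  by apply: nxK; exists u, v; rewrite ux in uv *.
rewrite inE => /orP[/eqP ->//|/fK /asboolP KK' K'u].
exact: tournament_asym uv (KK' _ _ Kv K'u).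
Qed.

(** Dual case: without an edge to [x], the set [K] itself would be closed under out-neighbours in
    [S]. *)
Lemma strong_edge_from_last S x K Ks : strongly_connected S -> S x -> ~ K x ->
  K !=set0 -> K `<=` S ->
  (forall v, S v -> v = x \/ exists2 K', K' \in rcons Ks K & K' v) ->
  all (fun A => `[< full A K >]) Ks ->
  edge_between K [set x].
Proof.
move=> /strongly_connectedP sS Sx Kx K0 KS cov /allP fK; apply: contrapT => nxK.
apply: Kx; have /(_ x Sx) : S `<=` K; last by [].
apply: sS => // u v Ku Sv uv; have [vx|[K']] := cov v Sv.
  by exfalso; apply: nxK; exists u, v; rewrite vx in uv *.
rewrite mem_rcons inE => /orP[/eqP ->//|/fK /asboolP KK' K'v].
by case: (tournament_asym uv (KK' _ _ K'v Ku)).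
Qed.

Lemma comp_restrict X C Y K : strong_component X C -> strong_component (X `|` Y) K ->
  C `&` K !=set0 -> K `<=` C.
Proof.
move=> hC [_ KXY sK _] CK; apply: comp_sub hC _ sK CK.
by move=> v /KXY + Xv; apply; left.
Qed.

End Tournament.

(** * Ends of nested components *)

Section Ends.
Variable D : digraph.
Implicit Types (S U K X Y C A B : set D) (u v x : D) (w : ends D).

Lemma tail_meet (r : nat -> D) C C' : has_tail_in r C -> has_tail_in r C' ->
  C `&` C' !=set0.
Proof.
move=> [k rk] [l rl]; exists (r (maxn k l)).
by split; [apply: rk (leq_maxl _ _) | apply: rl (leq_maxr _ _)].
Qed.

Lemma has_tail_in_sub (r : nat -> D) C C' : C `<=` C' ->
  has_tail_in r C -> has_tail_in r C'.
Proof. by move=> CC' [k rk]; exists k => n /rk /CC'. Qed.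

(** The default of [end_comp] is not reached for finite [X]: the component holding a tail of one
    representing ray holds a tail of every equivalent ray, as distinct components are disjoint. *)
Lemma end_compP X w : finite_set X ->
  strong_component X (end_comp X w) /\
  forall r, val w r -> has_tail_in r (end_comp X w).
Proof.
move=> fX; rewrite /end_comp; case: xgetP => [C _ //|none]; exfalso.
have := set_valP w => -[r [rr rs] ew].
have [C hC tC] := rs X fX; apply: (none C); split=> // s; rewrite ew => -[_ rs'].
have [C' [hC' trC' tsC']] := rs' X fX.
by rewrite (comp_eq hC hC') //; exact: tail_meet tC trC'.
Qed.

Lemma end_ray w : exists r, solid_ray r /\ val w r.
Proof.
have [r rs ew] := set_valP w; exists r; split=> //; rewrite ew; split=> // X fX.
by have [C hC tC] := rs.2 X fX; exists C.
Qed.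

Lemma end_comp_eq X w C r : finite_set X -> strong_component X C -> val w r ->
  has_tail_in r C -> end_comp X w = C.
Proof.
move=> fX hC wr tC; have [hw tw] := end_compP w fX.
by apply: comp_eq hw hC _; exact: tail_meet (tw r wr) tC.
Qed.

Lemma end_comp_sub X Y w : finite_set X -> finite_set Y -> X `<=` Y ->
  end_comp Y w `<=` end_comp X w.
Proof.
move=> fX fY XY; have [hX tX] := end_compP w fX; have [hY tY] := end_compP w fY.
have [_ YY sY _] := hY; have [r [_ wr]] := end_ray w.
apply: comp_sub hX _ sY _; first by move=> v /YY + /XY.
exact: tail_meet (tX r wr) (tY r wr).
Qed.

(** [end_ends] asks for a whole ray in the component. A tail is enough, because cutting off an
    initial segment changes neither solidity nor the end. *)
Lemma end_ends_tail X w (h : ends D) : finite_set X ->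
  (exists2 r, val h r & has_tail_in r (end_comp X w)) -> end_ends X w h.
Proof.
move=> fX [r hr [k rk]].
have [r0 rs0 eh] := set_valP h.
move: (hr); rewrite eh => -[[[rinj redge] rsol] r0r].
have tail_shift C : has_tail_in r C -> has_tail_in (fun n => r (n + k)%N) C.
  move=> [l rl]; exists l => n ln; apply: rl; exact: leq_trans ln (leq_addr _ _).
exists (fun n => r (n + k)%N); last by move=> v [n _ <-]; apply: rk; exact: leq_addl.
rewrite eh; split=> [|Y fY].
  split; last by move=> Y /rsol[C hC tC]; exists C => //; exact: tail_shift.
  split=> [m n /rinj/addIn //|n]; exact: redge.
have [C [hC tr0 tr]] := r0r Y fY; exists C; split=> //; exact: tail_shift.
Qed.

(** * An end defined by a decreasing sequence of components *)

Section NestedComponents.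
Variables (X C : nat -> set D).
Hypotheses (Xfin : forall n, finite_set (X n))
  (Xincr : forall m n, (m <= n)%N -> X m `<=` X n)
  (Xall : forall v, exists n, X n v)
  (Ccomp : forall n, strong_component (X n) (C n))
  (Cdecr : forall m n, (m <= n)%N -> C n `<=` C m).

Let finite_sub_X Y : finite_set Y -> exists n, Y `<=` X n.
Proof.
move=> /finite_seqP[s ->]; elim: s => [|v s [n sn]]; first by exists 0%N.
have [m vm] := Xall v; exists (maxn m n) => w /=; rewrite inE => /orP[/eqP ->|ws].
  by apply: Xincr vm; exact: leq_maxl.
by apply: (Xincr (leq_maxr m n)); exact: sn.
Qed.

(* A state [(a, p, m)] of the construction of a ray: the current vertex, the
   rest of a path that leads into [C m], and [m].  The ray follows the path up
   to its first vertex in [C m] and then heads for a later [C m']. *)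
Let state : Type := (D * seq D * nat)%type.
Let cur (s : state) := s.1.1.
Let pending (s : state) := s.1.2.
Let goal (s : state) := s.2.

Let inv (s : state) : Prop :=
  [/\ path (@edge D) (cur s) (pending s), uniq (cur s :: pending s),
      C (goal s) (last (cur s) (pending s)) & ~ C (goal s) (cur s)].

(** Regions decrease along the construction and contain all later vertices of the ray, but under
    [inv] never the current one. Injectivity of the ray follows. *)
Let region (s : state) : set D := [set v | v \in pending s \/ C (goal s) v].

Let next (s t : state) : Prop :=
  [/\ inv t, edge (cur s) (cur t), region s (cur t), region t `<=` region s &
   ((size (pending t) < size (pending s))%N /\ goal t = goal s) \/
   ((goal s < goal t)%N /\ region t `<=` C (goal s))].

Let launch (m : nat) v : C m v -> exists t : state,
  [/\ inv t, cur t = v, (m < goal t)%N & region t `<=` C m].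
Proof.
(* From index [k] on the vertex [v] is deleted, so it lies outside [C m'], and a path within [C m]
   leads from it into [C m']. *)
move=> Cv; have [k kv] := Xall v; pose m' := (maxn m.+1 k).
have mm' : (m < m')%N by exact: leq_maxl.
have nCv : ~ C m' v.
  have [_ CX _ _] := Ccomp m'; move=> /CX; apply.
  by apply: Xincr kv; exact: leq_maxr.
have [[b Cb] _ _ _] := Ccomp m'; have [_ _ sC _] := Ccomp m.
have [p [pp up lp pC]] := sC v b Cv (Cdecr (ltnW mm') Cb).
exists (v, p, m'); split=> //; first by split=> //=; rewrite lp.
move=> w [wp|/(Cdecr (ltnW mm'))//]; apply: pC.
by rewrite inE; apply/orP; right.
Qed.

Let next_exists (s : state) : inv s -> exists t, next s t.
Proof.
case: s => -[a [|b p] m] [/=]; first by move=> _ _.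
move=> /andP[ab bp] /and3P[anb bnp up] lC nCa.
(* Once the path enters [C m], its rest is dropped and a new path inside [C m] is launched; this is
   what shrinks the region into [C m]. *)
have [Cb|nCb] := pselect (C m b).
  have [t [it cb mt sub]] := launch Cb; exists t; split=> //=; rewrite ?cb //.
  - by left; rewrite /= inE eqxx.
  - by move=> v /sub; right.
  - by right.
exists (b, p, m); split=> //=.
- by split=> //=; rewrite bnp.
- by left; rewrite inE eqxx.
- by move=> v [/= vp|]; [left; rewrite /= inE vp orbT | right].
- by left.
Qed.

Let states : exists s : nat -> state, inv (s 0%N) /\ forall n, next (s n) (s n.+1).
Proof.
have [[v Cv] _ _ _] := Ccomp 0; have [t0 [it0 _ _ _]] := launch Cv.
have : forall t : {t | inv t}, exists t' : {t | inv t}, next (sval t) (sval t').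
  by move=> [t it]; have [t' nt] := next_exists it;
    have [it' _ _ _ _] := nt; exists (exist _ t' it').
move=> /choice[f fP]; exists (fun n => sval (iter n f (exist _ t0 it0))).
by split=> // n; rewrite iterS; exact: fP.
Qed.

(** The constructed ray has a tail in every [C n]. It is solid because a finite [Y] lies in some
    [X n], and then the strongly connected set [C n] lies in one component of D - [Y]. *)
Lemma nested_components_end : exists w : ends D, forall n, end_comp (X n) w = C n.
Proof.
have [s [s0 sS]] := states; pose r n := cur (s n).
have sI n : inv (s n) by case: n => [//|n]; have [] := sS n.
have reg m n : (m <= n)%N -> region (s n) `<=` region (s m).
  move=> /subnK <-; elim: (n - m)%N => [//|k IH].
  by rewrite addSn => v; have [_ _ _ H _] := sS (k + m)%N; move=> /H /IH.
have rreg m n : (m < n)%N -> region (s m) (r n).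
  by case: n => [//|n]; rewrite ltnS => /reg H; have [_ _ /H] := sS n.
have nreg n : ~ region (s n) (r n).
  by have [_ /= /andP[/negP u _] _ nC] := sI n; move=> [].
have rne m n : (m < n)%N -> r m <> r n.
  by move=> /rreg + E; rewrite -E; exact: nreg.
have rray : ray r.
  split=> [m n E|n]; last by have [] := sS n.
  by apply/eqP; case: ltngtP => // /rne; rewrite E.
have advance n : exists m, (goal (s n) < goal (s m))%N /\ region (s m) `<=` C (goal (s n)).
  have [k] := ubnP (size (pending (s n))); elim: k n => // k IH n.
  rewrite ltnS => sk; have [_ _ _ _ [[ls eg]|]] := sS n; last by exists n.+1.
  by rewrite -eg; apply: IH; exact: leq_trans ls sk.
have far n : exists m, (n <= goal (s m))%N.
  elim: n => [|n [m nm]]; first by exists 0%N.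
  by have [m' [lt _]] := advance m; exists m'; exact: leq_ltn_trans nm lt.
have rtail n : has_tail_in r (C n).
  have [m nm] := far n; have [m' [_ sub]] := advance m.
  exists m'.+1 => k /rreg /sub; exact: Cdecr.
have rsolid : solid_ray r.
  split=> // Y /finite_sub_X[n Yn]; have [Cn0 CX sC _] := Ccomp n.
  have [|K hK CK] := @strong_sub_comp _ Y (C n) Cn0 _ sC.
    by move=> v /CX + /Yn.
  by exists K => //; exact: has_tail_in_sub CK (rtail n).
have rend : ends D [set s' | solid_ray s' /\ ray_equiv r s'] by exists r.
exists (SigSub (mem_set rend)) => n; apply: (@end_comp_eq _ _ _ r) => //=.
by split=> // Y fY; have [K hK tK] := rsolid.2 Y fY; exists K.
Qed.

End NestedComponents.
End Ends.

(** * Words of strong components *)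

Section Words.
Variable D : digraph.
Implicit Types (S U K X Y C A B : set D) (u v x c : D).
Implicit Types (i j a b : set D * bool) (w : seq (set D * bool)).

Definition single A : Prop := exists v, A = [set v].

Definition in_closed S U : Prop :=
  forall u v, S u -> U v -> edge u v -> U u.

(* However many vertices are deleted from [C], its terminal strong component
   still has an edge to [B]. *)
Definition firm_right C B : Prop :=
  forall Y S, finite_set Y -> S !=set0 -> S `<=` C `\` Y ->
    out_closed (C `\` Y) S -> edge_between S B.

Definition firm_left A C : Prop :=
  forall Y S, finite_set Y -> S !=set0 -> S `<=` C `\` Y ->
    in_closed (C `\` Y) S -> edge_between A S.

(* Consecutive items of a word.  The flag of an item says on which side it is
   firm: on the right if it is [true], on the left otherwise. *)
Definition linked i j : Prop :=
  [/\ edge_between i.1 j.1, [\/ single i.1, single j.1 | full i.1 j.1],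
      i.2 -> firm_right i.1 j.1 & ~~ j.2 -> firm_left i.1 j.1].

Definition link : rel (set D * bool) := fun i j => `[< linked i j >].

Definition lone w : set D := [set v | exists2 i, i \in w & i.1 = [set v]].

Definition partitions w C : Prop :=
  forall v, count (fun i => v \in i.1) w = (v \in C).

Definition components X w : Prop :=
  forall i, i \in w -> ~ single i.1 ->
    strong_component (X `|` lone w) i.1.

Definition resolves X C c w : Prop :=
  [/\ partitions w C, components X w, lone w c & (1 < size w)%N].

Lemma full_firm_right C B : B !=set0 -> full C B -> firm_right C B.
Proof.
move=> B0 CB Y S _ S0 SC _; apply: full_edge_between => //.
by apply: full_subl CB => v /SC[].
Qed.

Lemma full_firm_left A C : A !=set0 -> full A C -> firm_left A C.
Proof.
move=> A0 AC Y S _ S0 SC _; apply: full_edge_between => //.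
by apply: full_subr AC => v /SC[].
Qed.

Lemma single_firm_right C B : single C -> edge_between C B -> firm_right C B.
Proof.
move=> [x ->] [u [b [-> Bb ub]]] Y S _ [v Sv] SC _; exists x, b; split=> //.
by have [<-] := SC v Sv.
Qed.

Lemma single_firm_left A C : single C -> edge_between A C -> firm_left A C.
Proof.
move=> [x ->] [a [u [Aa -> au]]] Y S _ [v Sv] SC _; exists a, x; split=> //.
by have [<-] := SC v Sv.
Qed.

Lemma firm_right_edge C B : C !=set0 -> firm_right C B -> edge_between C B.
Proof.
move=> C0 CB; apply: (CB set0) => //; first by rewrite setD0.
by move=> u v _ [].
Qed.

(** As [K] is terminal in [C] minus [Y], a terminal part of [K] minus [Z] is also terminal in [C]
    after deleting [Z] and the part of [Y] outside [K], and there the firmness of [C] applies. *)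
Lemma firm_right_sub C K B Y : finite_set Y -> K `<=` C ->
  (forall u v, K u -> C v -> ~ K v -> ~ Y v -> ~ edge u v) ->
  firm_right C B -> firm_right K B.
Proof.
move=> fY KC Kterm CB Z S fZ S0 SK Scl.
apply: (CB ((Y `\` K) `|` Z)) => //.
- by rewrite finite_setU; split=> //; exact: finite_setD.
- move=> v Sv; have [Kv Zv] := SK v Sv; split; first exact: KC.
  by move=> [[]|].
- move=> u v Su [Cv nYZ] uv; have [Ku Zu] := SK u Su.
  have [Kv|nKv] := pselect (K v).
    by apply: Scl Su _ uv; split=> // Zv; apply: nYZ; right.
  by case: (Kterm u v Ku Cv nKv _ uv) => Yv; apply: nYZ; left.
Qed.

Lemma linked_full i j : i.1 !=set0 -> j.1 !=set0 -> full i.1 j.1 -> linked i j.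
Proof.
move=> i0 j0 ij; split; first exact: full_edge_between.
- by apply: Or33.
- by move=> _; exact: full_firm_right.
- by move=> _; exact: full_firm_left.
Qed.

End Words.
Arguments link {D}.

(** * Refining one letter of a word *)

Section Refine.
Variables (D : digraph) (Dt : tournament D) (Ds : solid D).
Implicit Types (S U K X Y C A B : set D) (u v x c : D).
Implicit Types (i j a b : set D * bool) (w : seq (set D * bool)).

Lemma pairwise_full_count Ks v : pairwise (fun A B => `[< full A B >]) Ks ->
  count (fun K => v \in K) Ks = has (fun K => v \in K) Ks.
Proof.
elim: Ks => //= K Ks IH /andP[/allP KKs /IH ->].
have [vK|//] := boolP (v \in K); rewrite /= [has _ _](introF hasP) //.
move=> [K' /KKs /asboolP KK' vK']; rewrite !inE in vK vK'.
by have := KK' v v vK vK'; rewrite tournament_irr.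
Qed.

Definition mark (s : seq (set D)) : seq (set D * bool) := [seq (K, true) | K <- s].

(** A single round of refinement. Only the last component of [C] - [x] has to be linked to [b]; it
    is terminal in [C] - [x], so [firm_right_sub] applies to it. Every other component is full to
    its successor, hence firm. *)
Lemma split_vertex X C a b x : finite_set X -> strong_component X C ->
    ~ single C -> linked a (C, true) -> linked (C, true) b ->
    edge_between a.1 [set x] -> C x ->
  exists Ks : seq (set D), [/\
    path link a (rcons ((([set x] : set D), true) :: mark Ks) b),
    pairwise (fun A B => `[< full A B >]) Ks,
    partitions (([set x], true) :: mark Ks) C,
    forall K, K \in Ks -> strong_component (X `|` [set x]) K /\ K `<=` C &
    (0 < size Ks)%N].
Proof.
move=> fX hC nsC aC Cb ax Cx.
have fXx : finite_set (X `|` [set x]) by rewrite finite_setU; split=> //; exact: finite_set1.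
have [Ks [Kp KsP]] := sorted_comps Dt C Ds fXx.
have [C0 CX sC _] := hC.
have Knx K : K \in Ks -> ~ K x.
  by move=> /KsP[[_ + _ _] _] => /[apply]; apply; right.
have cover v : C v -> v = x \/ exists2 K, K \in Ks & K v.
  move=> Cv; have [->|/eqP nvx] := eqVneq v x; [by left | right].
  have [|K hK Kv] := @comp_exists _ (X `|` [set x]) v; first by move=> [/(CX v Cv)|].
  exists K => //; apply/KsP; split=> //; apply: comp_restrict hC hK _.
  by exists v.
have Ks0 : (0 < size Ks)%N.
  rewrite lt0n size_eq0; apply: contra_notN nsC => /eqP E; exists x.
  apply/seteqP; split=> [v /cover[//|[K]]|v -> //]; first by rewrite E.
exists Ks; split=> //; last 2 first.
- move=> v /=; rewrite count_map (eq_count (a2 := fun K => v \in K)) //.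
  rewrite (pairwise_full_count v Kp).
  have [Cv|nCv] := boolP (v \in C).
    rewrite inE in Cv; have [->|[K KKs Kv]] := cover v Cv.
      rewrite [x \in [set x]]mem_set // [has _ _](introF hasP) // => -[K /Knx nK].
      by rewrite inE.
    rewrite [has _ _](introT hasP); last by exists K => //; rewrite inE.
    rewrite [v \in _]memNset //= => vx; apply: (Knx K KKs); by rewrite -vx.
  rewrite [v \in _]memNset ?[has _ _](introF hasP) //.
    by move=> [K /KsP[_ KC]]; rewrite inE => /KC Cv; rewrite notin_setE in nCv.
  by move=> vx; rewrite notin_setE vx in nCv.
- by move=> K /KsP.
have Kne K : K \in Ks -> K !=set0 by move=> /KsP[[]].
rewrite /=; apply/andP; split.
  apply/asboolP; split=> //=; first by apply: Or32; exists x.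
  (* Firmness of [a] towards [C] says nothing about the one vertex [x]. But if [a] is not a vertex
     either, the link makes it full to [C], hence to [x]. *)
  move=> a2; have [_ saC aR _] := aC.
  have [sa|nsa] := pselect (single a.1); first exact: single_firm_right.
  have {}saC : full a.1 C by case: saC.
  by apply: full_firm_right; [exists x | apply: full_subr saC => v ->].
have linkKb K : K \in Ks -> (forall K', K' \in Ks -> K' <> K -> full K' K) ->
    linked (K, true) b.
  move=> KKs KK'; have [eCb sCb /(_ isT) CR bL] := Cb.
  have [hK KC] := (KsP K).1 KKs.
  have KR : firm_right K b.1.
    apply: firm_right_sub (finite_set1 x) KC _ CR => u v Ku Cv nKv nvx uv.
    have [//|[K' K'Ks K'v]] := cover v Cv.
    apply: (tournament_asym Dt uv); apply: (KK' K' K'Ks _ v u K'v Ku) => E.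
    by rewrite E in K'v.
  have eK : edge_between K b.1 by apply: firm_right_edge KR; exact: Kne.
  split=> //= [|b2].
    by case: sCb => // H; [apply: Or32 | apply: Or33; apply: full_subl H].
  case: sCb => // H; first exact: single_firm_left.
  by apply: full_firm_left; [exact: Kne | ]; move=> u v Ku bv; apply: H => //; exact: KC.
have KC K : K \in Ks -> K `<=` C by move=> /KsP[].
rewrite rcons_path; apply/andP; split.
  case: Ks Ks0 Kp Knx cover Kne KC {KsP linkKb} => // K Ks _ /=.
  move=> /andP[fK Kp] Knx cover Kne KC.
  have K0 : K !=set0 by apply: Kne; rewrite inE eqxx.
  apply/andP; split.
    apply/asboolP.
    have xK : edge_between [set x] K.
      apply: (strong_edge_to_first Dt sC Cx _ K0 _ cover fK).
        by apply: Knx; rewrite inE eqxx.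
      by apply: KC; rewrite inE eqxx.
    have x1 : single [set x] by exists x.
    split=> //=; [exact: Or31 | by move=> _; exact: single_firm_right].
  have : pairwise (fun A B => `[< full A B >]) (K :: Ks) by rewrite /= fK.
  move=> /pairwise_sorted /=; rewrite path_map.
  elim: Ks K K0 Kne {fK Kp Knx cover KC} => //= K' Ks IH K K0 Kne /andP[/asboolP KK' KKs].
  have K'0 : K' !=set0 by apply: Kne; rewrite !inE eqxx orbT.
  apply/andP; split; first by apply/asboolP; exact: linked_full.
  by apply: IH => // K'' K''s; apply: Kne; rewrite inE K''s orbT.
case: (lastP Ks) Ks0 Kp Knx cover Kne KC linkKb {KsP} => // Ks' K _ Kp Knx cover Kne KC linkKb.
rewrite /mark map_rcons last_rcons; apply/asboolP.
have KK : K \in rcons Ks' K by rewrite mem_rcons inE eqxx.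
apply: linkKb => // K' K'K nK'K; move: Kp; rewrite pairwise_rcons => /andP[/allP fK _].
by move: K'K; rewrite mem_rcons inE => /orP[/eqP //|/fK /asboolP].
Qed.

Lemma partitions_inj w C i j v : partitions w C -> i \in w -> j \in w ->
  i.1 v -> j.1 v -> i = j.
Proof.
move=> wC iw jw iv jv; have := wC v; case: (splitPr iw) jw => s1 s2.
rewrite count_cat /= [v \in i.1]mem_set // => jw cnt.
have {}cnt : (count (fun i : set D * bool => v \in i.1) s1 = 0 /\
    count (fun i : set D * bool => v \in i.1) s2 = 0)%N.
  by move: cnt; case: (v \in C); lia.
have no s : count (fun i : set D * bool => v \in i.1) s = 0%N -> j \notin s.
  move=> c0; apply/negP => js; have : has (fun i : set D * bool => v \in i.1) s.
    by apply/hasP; exists j => //; rewrite inE.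
  by rewrite has_count c0.
move: jw; rewrite mem_cat inE (negbTE (no _ cnt.1)) (negbTE (no _ cnt.2)) /= orbF.
by move/eqP.
Qed.

Lemma partitions_sub w C i : partitions w C -> i \in w -> i.1 `<=` C.
Proof.
move=> wC iw v iv; have := wC v; have [|_] := boolP (v \in C); first by rewrite inE.
move/eqP; rewrite eqn0Ngt -has_count => /hasP; case; exists i => //.
by rewrite inE.
Qed.

(** The letters are disjoint, so vertices resolved in other letters can be deleted as well without
    disturbing the component [i]. *)
Lemma comp_widen_lone X Y C w i : C `<=` ~` X -> partitions w C ->
  i \in w -> ~ single i.1 -> Y `<=` X `|` lone w ->
  strong_component Y i.1 -> strong_component (X `|` lone w) i.1.
Proof.
move=> CX wC iw nsi YX hi; apply: comp_widen hi YX _ => v iv [Xv|[j jw jv]].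
  by apply: CX Xv; exact: partitions_sub wC iw v iv.
apply: nsi; exists v; rewrite -jv; congr (_.1).
by apply: partitions_inj wC iw jw iv _; rewrite jv.
Qed.

(** Proceeds backwards from the end of the path. It is used for the first component of [C] - [x],
    which no edge enters from the later ones. *)
Lemma path_pred_closed K y p : path (@edge D) y p -> K (last y p) ->
  (forall u v, u \in y :: p -> K v -> edge u v -> K u) ->
  forall z, z \in y :: p -> K z.
Proof.
elim: p y => [|z p IH] y /=; first by move=> _ Ky _ z; rewrite inE => /eqP ->.
move=> /andP[yz zp] Kl cl.
have zK : forall t, t \in z :: p -> K t.
  by apply: IH => // u v uzp; apply: cl; rewrite inE uzp orbT.
move=> t; rewrite inE => /orP[/eqP ->|/zK //].
by apply: cl yz; [rewrite inE eqxx | apply: zK; rewrite inE eqxx].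
Qed.

Lemma path_link_subst a s1 k s2 b : path link a (rcons (s1 ++ k :: s2) b) ->
  exists b', [/\ linked (last a s1) k, linked k b' &
    forall w, path link (last a s1) (rcons w b') ->
      path link a (rcons (s1 ++ w ++ s2) b)].
Proof.
rewrite rcons_cat rcons_cons cat_path /= => /and3P[as1 /asboolP s1k].
case E : (rcons s2 b) => [|b' R] /=; first by case: (s2) E.
move=> /andP[/asboolP kb' bR]; exists b'; split=> // w pw.
rewrite !rcons_cat E cat_path as1 /= -cat_rcons cat_path pw last_rcons.
exact: bR.
Qed.

(** Induction on the length of the path from [x] to the vertex that is to be resolved. After
    splitting at [x], the end of the path lies in some component [K]; only [K] is refined further,
    between its neighbours in the new word and along a shorter path. *)
Lemma refine_right p X C a b x : finite_set X -> strong_component X C ->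
    ~ single C -> linked a (C, true) -> linked (C, true) b ->
    edge_between a.1 [set x] -> path (@edge D) x p -> uniq (x :: p) ->
    (forall z, z \in x :: p -> C z) ->
  exists w, path link a (rcons w b) /\ resolves X C (last x p) w.
Proof.
have [n] := ubnP (size p); elim: n => // n IH in p X C a b x *.
rewrite ltnS => pn fX hC nsC aC Cb ax xp up pC.
have Cx : C x by apply: pC; rewrite inE eqxx.
have [Ks [Kspath Ksfull Kspart KsP Ks0]] := split_vertex fX hC nsC aC Cb ax Cx.
have [_ CX sC _] := hC; set w0 := _ :: mark Ks in Kspath Kspart.
have xw0 : ([set x], true) \in w0 by rewrite inE eqxx.
have w0comp : components X w0.
  move=> i iw nsi; move: (iw); rewrite inE => /orP[/eqP ei|].
    by case: nsi; exists x; rewrite ei.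
  move=> /mapP[K /KsP[hK _] ei]; rewrite ei /= in nsi *.
  rewrite ei in iw.
  apply: comp_widen_lone CX Kspart iw nsi _ hK => v [Xv|->]; first by left.
  by right; exists ([set x], true).
have resolved c : lone w0 c -> exists w, path link a (rcons w b) /\ resolves X C c w.
  by move=> w0c; exists w0; split=> //; split=> //; rewrite /= ltnS size_map.
case: p => [|y p] /= in pn xp up pC *; first by apply: resolved; exists ([set x], true).
have /andP[xy yp] := xp; have /andP[nxp uyp] := up.
set c := last y p.
have cyp : c \in y :: p by exact: mem_last.
have Cc : C c by apply: pC; rewrite inE cyp orbT.
have [K KKs Kc] : exists2 K, K \in Ks & K c.
  have := Kspart c; rewrite /= [c \in C]mem_set // [c \in [set x]]memNset.
    rewrite add0n => /eqP cnt; have : has (fun i : set D * bool => c \in i.1) (mark Ks).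
      by rewrite has_count (eqP cnt).
    by move=> /hasP[_ /mapP[K KKs ->]] /=; rewrite inE; exists K.
  by move=> /= cx; move: nxp; rewrite -cx cyp.
have [[v Kv]|nsK] := pselect (single K).
  apply: resolved; exists (K, true); first by rewrite inE map_f ?orbT.
  by rewrite /= Kv in Kc *; rewrite Kc.
have [hK KC] := KsP K KKs.
have KX v : K v -> v <> x by have [_ H _ _] := hK; move=> /H + E; apply; right.
have fXx : finite_set (X `|` [set x]) by rewrite finite_setU; split=> //; exact: finite_set1.
have [Ks1 [Ks2 eKs]] : exists Ks1 Ks2, Ks = Ks1 ++ K :: Ks2.
  by case: (splitPr KKs) => Ks1 Ks2; exists Ks1, Ks2.
pose s1 := ([set x], true) :: mark Ks1.
have ew0 : w0 = s1 ++ (K, true) :: mark Ks2 by rewrite /w0 eKs /mark map_cat.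
move: (Kspath); rewrite ew0 => /path_link_subst[b' [aK Kb' subst]].
have [x' [p' [p'n axx xp' up' [p'K lp']]]] : exists x' p', [/\ (size p' < n)%N,
    edge_between (last a s1).1 [set x'], path (@edge D) x' p', uniq (x' :: p') &
    (forall z, z \in x' :: p' -> K z) /\ last x' p' = c].
  (* If [K] comes first, the rest of the path stays in [K], since it ends there and nothing enters
     [K] from a later component. Otherwise the preceding component is full to [K], and [c] can be
     entered at once, with an empty path. *)
  case: (lastP Ks1) @s1 eKs {ew0 aK subst} => [|Ks1' K0] s1 eKs.
    exists y, p; split=> //; first by exists x, y.
    split=> //; apply: path_pred_closed yp Kc _ => u v uq Kv uv.
    have ux : u <> x by move=> E; rewrite -E uq in nxp.
    have Cu : C u by apply: pC; rewrite inE uq orbT.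
    have := Kspart u; rewrite [u \in C]mem_set //= [u \in [set x]]memNset // add0n.
    move=> /eqP cnt; have : has (fun i : set D * bool => u \in i.1) (mark Ks).
      by rewrite has_count (eqP cnt).
    move=> /hasP[_ /mapP[K' K'Ks ->]] /=; rewrite inE => K'u.
    move: K'Ks Ksfull; rewrite eKs /= inE => /orP[/eqP <- //|K'2] /andP[/allP fK _].
    by case: (tournament_asym Dt uv); have /asboolP := fK K' K'2; apply.
  exists c, [::]; split=> //=.
  - by case: n pn {IH}.
  - have K0Ks : K0 \in Ks by rewrite eKs mem_cat mem_rcons inE eqxx.
    have [[[u K0u] _ _ _] _] := KsP K0 K0Ks.
    rewrite /mark map_rcons last_rcons; exists u, c; split=> //.
    move: Ksfull; rewrite eKs cat_rcons pairwise_cat.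
    by move=> /and3P[_ _ /= /andP[/andP[/asboolP fK _] _]]; exact: fK.
  - by split=> // z; rewrite inE => /eqP ->.
have [wK [wKpath [wKpart wKcomp wKc wK2]]] :=
  IH p' _ K _ b' x' p'n fXx hK nsK aK Kb' axx xp' up' p'K.
rewrite lp' in wKc; pose w := s1 ++ wK ++ mark Ks2.
have wpart : partitions w C.
  by move=> v; rewrite -Kspart ew0 !count_cat /= wKpart.
have sub : lone wK `<=` lone w.
  by move=> v [i iwK iv]; exists i => //; rewrite !mem_cat iwK orbT.
have xw : lone w x by exists ([set x], true) => //; rewrite inE eqxx.
exists w; split; first exact: subst.
split=> //; last 2 first.
- exact: sub.
- by rewrite !size_cat addnCA (leq_trans wK2) // leq_addr.
have marked i : i \in mark Ks -> ~ single i.1 -> i \in w ->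
    strong_component (X `|` lone w) i.1.
  move=> /mapP[K' /KsP[hK' _] ->] nsi iw.
  by apply: comp_widen_lone CX wpart iw nsi _ hK' => v [|->]; [left | right].
move=> i iw nsi; move: (iw); rewrite mem_cat inE -orbA => /or3P[/eqP ei||].
- by case: nsi; exists x; rewrite ei.
- by move=> i1; apply: marked => //; rewrite eKs /mark map_cat mem_cat i1.
rewrite mem_cat => /orP[iwK|i2]; last first.
  by apply: marked => //; rewrite eKs /mark map_cat mem_cat inE i2 !orbT.
apply: comp_widen_lone CX wpart iw nsi _ (wKcomp i iwK nsi).
by move=> v [[|->]|/sub]; [left | right | right].
Qed.
(** The link gives some edge from [a] into [C]; the path to [c] starts at its head. *)
Lemma refine_flagged X C a b c : finite_set X -> strong_component X C ->
    ~ single C -> linked a (C, true) -> linked (C, true) b -> C c ->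
  exists w, path link a (rcons w b) /\ resolves X C c w.
Proof.
move=> fX hC nsC aC Cb Cc; have [_ _ sC _] := hC.
have [[u [x [au Cx ux]]] _ _ _] := aC.
have [p [pp up lp pC]] := sC x c Cx Cc; rewrite -lp.
by apply: refine_right pp up pC => //; exists u, x.
Qed.

End Refine.

(** * Reversal of all edges *)

Section Converse.
Variable D : digraph.
Implicit Types (S X C : set D) (i j : set D * bool) (w : seq (set D * bool)).

Definition converse : digraph := Digraph (fun u v : D => edge v u).

(** Reversal exchanges firmness on the right with firmness on the left, hence the negated flag. *)
Definition flip i : set converse * bool := (i.1, ~~ i.2).

Lemma converse_tournament : tournament D -> tournament converse.
Proof. by move=> [irr tot]; split=> // u v /tot; rewrite addbC. Qed.

Lemma converse_edge_between (A B : set D) :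
  edge_between A B -> edge_between (B : set converse) A.
Proof. by move=> [u [v [Au Bv uv]]]; exists v, u. Qed.

(** A set closed under out-neighbours in the converse has a complement in [S] that is closed in
    [D]. *)
Lemma converse_strongly_connected S :
  strongly_connected S -> strongly_connected (S : set converse).
Proof.
move=> /strongly_connectedP sS; apply/strongly_connectedP => U sU [u Uu] Ucl v Sv.
apply: contrapT => nUv; suff /(_ u (sU u Uu))[] : S `<=` S `\` U by [].
apply: sS => [w []//||a b [Sa nUa] Sb ab]; first by exists v.
by split=> // Ub; apply: nUa; apply: Ucl ab.
Qed.

End Converse.

Lemma converse_strong_component (D : digraph) (X C : set D) :
  strong_component X C -> strong_component (X : set (converse D)) C.
Proof.
move=> [C0 CX sC max]; split=> //; first exact: converse_strongly_connected.
move=> C' CC' C'X sC'; apply: max => //.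
(* The edges of the double converse compute to those of [D]. *)
exact: (@converse_strongly_connected (converse D)).
Qed.

Lemma converse_solid (D : digraph) : solid D -> solid (converse D).
Proof.
move=> Ds X fX; apply: sub_finite_set (Ds X fX) => C.
exact: (@converse_strong_component (converse D)).
Qed.

Lemma converse_linked (D : digraph) (i j : set D * bool) :
  linked i j -> linked (flip j) (flip i).
Proof.
move=> [ij sij iR jL]; split=> /=; first exact: converse_edge_between.
- by case: sij => H; [apply: Or32 | apply: Or31 | apply: Or33 => a b aj bi; exact: H].
- move=> j2 Y S fY S0 SC Scl; apply: converse_edge_between.
  by apply: (jL j2 Y S fY S0 SC) => u v Su Sv uv; exact: Scl Sv Su uv.
- move=> /negPn i2 Y S fY S0 SC Scl; apply: converse_edge_between.
  by apply: (iR i2 Y S fY S0 SC) => u v Su Sv uv; exact: Scl Sv Su uv.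
Qed.

Lemma converse_path_link (D : digraph) (a b : set D * bool) w :
  path link a (rcons w b) ->
  path link (flip b) (rcons (rev (map (@flip D) w)) (flip a)).
Proof.
have := rev_path (fun i j => link j i) a (rcons w b).
rewrite last_rcons belast_rcons rev_cons -map_rev => E p.
have {E}p : path (fun i j => link j i) b (rcons (rev w) a) by rewrite E.
have -> : rcons (map (@flip D) (rev w)) (flip a) = map (@flip D) (rcons (rev w) a).
  by rewrite map_rcons.
rewrite path_map; apply: sub_path p => i j /asboolP ij.
by apply/asboolP; exact: converse_linked.
Qed.

Lemma converse_resolves (D : digraph) (X C : set D) c w : resolves X C c w ->
  resolves (X : set (converse D)) C c (rev (map (@flip D) w)).
Proof.
move=> [wC wcomp wc w2].
have sing : lone (rev (map (@flip D) w)) = lone w.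
  apply/seteqP; split=> v [i].
    by rewrite mem_rev => /mapP[j jw ->] jv; exists j.
  by move=> iw iv; exists (flip i) => //; rewrite mem_rev map_f.
split; rewrite ?sing ?size_rev ?size_map //.
  by move=> v; rewrite count_rev count_map -wC.
move=> i; rewrite mem_rev => /mapP[j jw ->] nsj; rewrite sing.
exact: converse_strong_component (wcomp j jw nsj).
Qed.

(** A letter firm on the left becomes one firm on the right in the converse tournament, where the
    word is read backwards; the refined word is then reversed again. *)
Lemma refine (D : digraph) (X C : set D) f a b c :
    tournament D -> solid D -> finite_set X -> strong_component X C ->
    ~ single C -> linked a (C, f) -> linked (C, f) b -> C c ->
  exists w, path link a (rcons w b) /\ resolves X C c w.
Proof.
move=> Dt Ds fX hC nsC; case: f => aC Cb Cc; first exact: refine_flagged aC Cb Cc.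
have [w [wp wr]] := refine_flagged (converse_tournament Dt) (converse_solid Ds)
  fX (converse_strong_component hC) nsC (converse_linked Cb) (converse_linked aC) Cc.
exists (rev (map (@flip (converse D)) w)); split.
  have := converse_path_link wp.
  by rewrite /flip /= !negbK; case: (a) (b) => [? ?] [? ?].
exact: (converse_resolves wr).
Qed.

(** * The first word *)

Section InitialWord.
Variables (D : digraph) (Dt : tournament D) (Ds : solid D).
Hypotheses (Dinf : infinite_set [set: D]) (Dstrong : strongly_connected [set: D]).
Implicit Types (S U K X Y C A B : set D) (u v x c : D).

Definition vertex_item v : set D * bool := ([set v], true).

(** The word is read from [v] round to [v], but [W] lists this vertex only at its end, so that each
    vertex is counted once. *)
Definition cyclic_word v (W : seq (set D * bool)) : Prop :=
  [/\ path link (vertex_item v) W, last (vertex_item v) W = vertex_item v,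
      partitions W setT, components set0 W & (1 < size W)%N].

(** The last clause carries the induction: if [x] has an edge to [v], then [v] is inserted into the
    rest [y :: p], whose new first vertex is [y] or [v], and [x] has an edge to both. *)
Lemma hamilton_path_insert v x (p : seq D) : path (@edge D) x p -> v \notin x :: p ->
  exists x' p', [/\ perm_eq (x' :: p') (v :: x :: p), path (@edge D) x' p' &
    x' = x \/ x' = v].
Proof.
elim: p x => [|y p IH] x.
  rewrite inE => _ /eqP vx; have [vex|/negP nvx] := boolP (edge v x).
    by exists v, [:: x]; rewrite /= vex; split=> //; right.
  have xv := tournament_total Dt vx nvx.
  exists x, [:: v]; rewrite /= xv; split=> //; last by left.
  exact/permPl/(perm_catC [:: x] [:: v]).
move=> /= /andP[xy yp]; rewrite inE => /norP[/eqP vx vyp].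
have [vex|/negP nvx] := boolP (edge v x).
  by exists v, (x :: y :: p); rewrite /= vex xy yp; split=> //; right.
have xv := tournament_total Dt vx nvx.
have [x' [p' [perm pp' x'yv]]] := IH y yp vyp.
exists x, (x' :: p'); split; last by left.
  rewrite (perm_trans (y := x :: v :: y :: p)) ?perm_cons //.
  exact/permPl/(perm_catCA [:: x] [:: v] (y :: p)).
by rewrite /= pp' andbT; case: x'yv => ->.
Qed.

Lemma finite_hamilton_path (s : seq D) : uniq s -> s != [::] ->
  exists x p, perm_eq (x :: p) s /\ path (@edge D) x p.
Proof.
elim: s => // v s IH /= /andP[vs us] _.
have [->|s0] := eqVneq s [::]; first by exists v, [::].
have [x [p [xp px]]] := IH us s0.
have [|x' [p' [perm pp' _]]] := hamilton_path_insert px (v := v).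
  by rewrite (perm_mem xp).
by exists x', p'; split=> //; rewrite (perm_trans perm) // perm_cons.
Qed.

(** The complement of [v] is firm: a terminal part of it after the deletion of [Y], if without an
    edge to [v], would be closed in D - ([Y] - [v]), which is strongly connected and contains
    [v]. *)
Lemma robust_cyclic_word v :
  (forall X, finite_set X -> strongly_connected (~` X)) ->
  cyclic_word v [:: (~` [set v], true); vertex_item v].
Proof.
move=> robust; have [u uv] : exists u, u <> v.
  apply: contrapT => none; apply: Dinf; apply: sub_finite_set (finite_set1 v) => u _ /=.
  by apply: contrapT => uv; apply: none; exists u.
have v1 : single [set v] by exists v.
have out : edge_between [set v] (~` [set v]).
  apply: contrapT => nout; apply: uv.
  apply: (proj1 (strongly_connectedP setT) Dstrong [set v]) => //; first by exists v.
  by move=> a b av _ ab; apply: contrapT => bv; apply: nout; exists a, b.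
have inR : firm_right (~` [set v]) [set v].
  move=> Y S fY S0 SC Scl; apply: contrapT => nSv.
  have fY' : finite_set (Y `\ v) by exact: finite_setD.
  have Sv : S v.
    apply: (proj1 (strongly_connectedP (~` (Y `\ v))) (robust _ fY') S) => //.
    - by move=> w /SC[wv Yw] [].
    - move=> a b Sa Yb ab; apply: (Scl a) => //.
      have bv : b <> v by move=> bv; apply: nSv; exists a, b.
      by split=> // Yb'; apply: Yb.
    - by move=> [_]; apply.
  by have [/(_ erefl)] := SC v Sv.
split=> //.
- apply/and3P; split=> //; apply/asboolP; split=> //.
  + exact: Or31.
  + by move=> _; exact: single_firm_right.
  + by apply: firm_right_edge => //; exists u.
  + exact: Or32.
- by move=> w; rewrite /= in_setC in_setT; case: (w \in [set v]).
- move=> i; rewrite !inE => /orP[] /eqP -> // nsv; split=> /=.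
  + by exists u.
  + move=> w wv [//|[j]]; rewrite !inE => /orP[] /eqP -> /= E.
      by apply: nsv; exists w.
    by apply: wv; rewrite E.
  + by apply: robust; exact: finite_set1.
  + move=> C' CC' C'X _; apply/seteqP; split=> // w /C'X nw wv; apply: nw; right.
    by exists (vertex_item v); rewrite ?inE ?eqxx ?orbT //= wv.
Qed.

(** Take a separator [s] of least size. Putting back one vertex [x] of it gives a strongly connected
    digraph, so [x] has an edge to the first component and one from the last. There are at least two
    components, because the remainder is infinite and not strong. *)
Lemma separator_cyclic_word X : finite_set X -> ~ strongly_connected (~` X) ->
  exists v W, cyclic_word v W.
Proof.
move=> fX nX.
have [s [us ns smin]] : exists s : seq D, [/\ uniq s,
    ~ strongly_connected (~` [set` s]) &
    forall s' : seq D, (size s' < size s)%N -> strongly_connected (~` [set` s'])].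
  pose P n := `[< exists s : seq D, size s = n /\ ~ strongly_connected (~` [set` s]) >].
  have exP : exists n, P n.
    by have /finite_seqP[s Xs] := fX; exists (size s); apply/asboolP; exists s; rewrite -Xs.
  case: (ex_minnP exP) => n /asboolP[s [sn ns]] nmin.
  have smin (s' : seq D) : (size s' < n)%N -> strongly_connected (~` [set` s']).
    move=> lt; apply: contrapT => ns'; have /nmin : P (size s') by apply/asboolP; exists s'.
    by rewrite leqNgt lt.
  exists (undup s).
  have es : [set` undup s] = [set` s] by apply/seteqP; split=> v /=; rewrite mem_undup.
  rewrite es; split=> [||s' lt]; [exact: undup_uniq | by [] |]; apply: smin; apply: leq_trans lt _.
  by rewrite -sn size_undup.
have sX : finite_set [set` s] by exact: finite_seq.
have s0 : s != [::].
  by apply: contra_notN ns => /eqP ->; rewrite set_nil setC0.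
have [x1 [xs [perm xsp]]] := finite_hamilton_path us s0.
have [Ks [Kp KsP]] := sorted_comps Dt setT Ds sX.
have cover v : v \notin s -> exists2 K, K \in Ks & K v.
  move=> /negP vs; have [K hK Kv] := @comp_exists _ [set` s] v vs.
  by exists K => //; apply/KsP.
have Kns K v : K \in Ks -> K v -> v \notin s by move=> /KsP[[_ + _ _] _] => /[apply] /negP.
have Kne K : K \in Ks -> K !=set0 by move=> /KsP[[]].
have Ks2 : (1 < size Ks)%N.
  case: Ks KsP cover {Kp Kne Kns} => [|K [|//]] KsP cover.
    exfalso; apply: Dinf; apply: sub_finite_set sX => v _ /=; apply: contrapT => /negP.
    by move=> /cover[].
  exfalso; apply: ns; have [[_ KX sK _] _] := (KsP K).1 (mem_head _ _).
  suff -> : ~` [set` s] = K by [].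
  apply/seteqP; split=> // v /negP/cover[K']; by rewrite inE => /eqP ->.
pose xl := last x1 xs.
have xlW : xl \in s by rewrite -(perm_mem perm) mem_last.
have x1W : x1 \in s by rewrite -(perm_mem perm) mem_head.
have remS x : x \in s -> strongly_connected (~` [set` rem x s]).
  by move=> xins; apply: smin; rewrite size_rem // ltn_predL; case: (s) xins.
have remT x v : x \in s -> (~` [set` rem x s]) v -> v = x \/ v \notin s.
  move=> xins /=; have [|vs _] := boolP (v \in s); last by right.
  by move=> vs; rewrite mem_rem_uniq // inE vs andbT => /negP/negPn/eqP; left.
have remx x : (~` [set` rem x s]) x by rewrite /= mem_rem_uniqF.
have remK x K : K \in Ks -> K `<=` ~` [set` rem x s].
  by move=> KKs v Kv /= /mem_rem; apply/negP; exact: Kns Kv.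
case: (lastP Ks) Kp KsP cover Kns Kne Ks2 remK => // Ks' Kl.
case: Ks' => // K1 Ks' Kp KsP cover Kns Kne _ remK.
have K1Ks : K1 \in rcons (K1 :: Ks') Kl by rewrite mem_head.
have KlKs : Kl \in rcons (K1 :: Ks') Kl by rewrite mem_rcons mem_head.
have xlK1 : edge_between [set xl] K1.
  apply: (strong_edge_to_first Dt (remS _ xlW) (remx _) _ (Kne _ K1Ks) (remK _ _ K1Ks)
    (Ks := rcons Ks' Kl)).
  - by move=> /(Kns _ _ K1Ks)/negP.
  - by move=> v /(remT _ _ xlW)[->|/cover]; [left | right].
  - by move: Kp; rewrite rcons_cons /= => /andP[].
have Klx1 : edge_between Kl [set x1].
  apply: (strong_edge_from_last Dt (remS _ x1W) (remx _) _ (Kne _ KlKs) (remK _ _ KlKs)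
    (Ks := K1 :: Ks')).
  - by move=> /(Kns _ _ KlKs)/negP.
  - by move=> v /(remT _ _ x1W)[->|/cover]; [left | right].
  - by move: Kp; rewrite pairwise_rcons => /andP[].
(* About [Kl] and [x1] only one edge is known, but [Kl] is full from its predecessor; hence its flag
   names the left side. *)
pose W := map vertex_item xs ++ mark (K1 :: Ks') ++ [:: (Kl, false); vertex_item x1].
have in1 (v x : D) : (v \in [set x]) = (x == v) by apply/idP/eqP; rewrite inE.
have Wpart : partitions W setT.
  move=> v; rewrite in_setT /W !count_cat.
  have -> : count (fun i : set D * bool => v \in i.1) (map vertex_item xs) = count_mem v xs.
    by rewrite count_map; apply: eq_count => x; rewrite /= in1.
  have cntK : (count (fun i : set D * bool => v \in i.1) (mark (K1 :: Ks')) + (v \in Kl) =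
      (v \notin s))%N.
    transitivity (count (fun K => v \in K) (rcons (K1 :: Ks') Kl)).
      by rewrite -cats1 count_cat count_map /= addn0.
    rewrite (pairwise_full_count Dt v Kp); congr nat_of_bool; apply/hasP/idP.
      by move=> [K KKs]; rewrite inE; exact: Kns.
    by move=> /cover[K KKs Kv]; exists K => //; rewrite inE.
  have cnts : ((x1 == v) + count_mem v xs = (v \in s))%N.
    by rewrite -(count_uniq_mem v us) -(permP perm).
  move: cntK cnts; rewrite -/(mark (K1 :: Ks')) /= in1; case: (v \in s); clear; lia.
have inW x : x \in s -> vertex_item x \in W.
  rewrite -(perm_mem perm) inE mem_cat => /orP[/eqP ->|xxs].
    by rewrite !mem_cat !inE eqxx !orbT.
  by rewrite map_f.
exists x1, W; split=> //.
- rewrite /W cat_path; apply/andP; split.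
    rewrite path_map; apply: sub_path xsp => x y xy; apply/asboolP.
    by apply: linked_full; [exists x | exists y | move=> a b -> ->].
  rewrite last_map -/xl /=.
  have xl1 : single [set xl] by exists xl.
  apply/andP; split; first apply/asboolP.
    by split=> //=; [exact: Or31 | move=> _; exact: single_firm_right].
  have : path link (K1, true) (rcons (mark Ks') (Kl, false)).
    have := pairwise_sorted Kp; rewrite /= => Kpath.
    have : all (fun K => `[< K !=set0 >]) (rcons Ks' Kl).
      by apply/allP => K KKs; apply/asboolP; apply: Kne; rewrite inE KKs orbT.
    have : K1 !=set0 by exact: Kne.
    elim: (Ks') (K1) Kpath => [|K2 Ks2 IH] K0 /= /andP[/asboolP f fs] K00 /andP[/asboolP K20 Ks20].
      by rewrite andbT; apply/asboolP; exact: linked_full.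
    by apply/andP; split; [apply/asboolP; exact: linked_full | exact: IH].
  rewrite -cats1 !cat_path /= => /and3P[-> -> _] /=; rewrite andbT; apply/asboolP.
  by split=> //=; apply: Or32; exists x1.
- by rewrite !last_cat.
- move=> i iW nsi; have : i.1 \in rcons (K1 :: Ks') Kl.
    have iW' := iW; rewrite !mem_cat !inE -!orbA in iW'.
    case/or4P: iW' => [/mapP[x _ ei]|/eqP -> |/mapP[K KKs ->]|].
    + by case: nsi; rewrite ei; exists x.
    + exact: K1Ks.
    + by rewrite rcons_cons inE mem_rcons inE KKs !orbT.
    + move=> /orP[/eqP ->|/eqP ei]; first exact: KlKs.
      by case: nsi; rewrite ei; exists x1.
  move=> /KsP[hi _]; apply: comp_widen_lone Wpart iW nsi _ hi.
    by move=> v _ [].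
  by move=> x /= /inW xW; right; exists (vertex_item x).
- by rewrite /W !size_cat /= addnA addn2.
Qed.

Lemma cyclic_word_exists : exists v W, cyclic_word v W.
Proof.
have [robust|] := pselect (forall X, finite_set X -> strongly_connected (~` X)).
  have [v _] : exists v : D, True.
    apply: contrapT => none; apply: Dinf; apply: sub_finite_set (finite_set0 D) => v _.
    by apply: none; exists v.
  by exists v, [:: (~` [set v], true); vertex_item v]; exact: robust_cyclic_word.
by move=> /existsNP[X /not_implyP[fX nX]]; exact: separator_cyclic_word nX.
Qed.

End InitialWord.

(** * Words laid out in the unit interval *)

Section TimedWords.
Local Open Scope ring_scope.
Variables (R : realType) (D : digraph).

Local Notation timed := ((set D * bool) * (R * R))%type.
Implicit Types (i j : timed) (s : seq timed) (l r h : R).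

Definition iset i : set D := i.1.1.
Definition lo i : R := i.2.1.
Definition hi i : R := i.2.2.
Definition before : rel timed := fun i j => hi i < lo j.

Definition well_timed i : Prop :=
  lo i <= hi i /\ (lo i = hi i <-> single (iset i)).

Definition below i j : Prop :=
  [/\ iset i `<=` iset j, lo j <= lo i & hi i <= hi j].

(** Letters and the gaps between them occupy slots of length [h] alternately, so k letters take 2k -
    1 slots. A vertex sits at the right end of its slot, which puts the end of the last letter where
    it is wanted. *)
Let slots (w : seq (set D * bool)) l h : 0 < h -> w != [::] ->
  exists i s, [/\ map fst (i :: s) = w, path before i s,
    hi (last i s) = l + h *+ ((size w).*2.-1) &
    forall j, j \in i :: s -> [/\ l <= lo j, hi j <= l + h *+ ((size w).*2.-1),
      well_timed j & hi j - lo j <= h]].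
Proof.
move=> h0; elim: w l => // c w IH l _.
have [i0 [i0c i0hi il iw ih]] : exists i0 : timed, [/\ i0.1 = c, hi i0 = l + h,
    l <= lo i0, well_timed i0 & hi i0 - lo i0 <= h].
  have [sc|nsc] := pselect (single c.1).
    by exists (c, (l + h, l + h)); split=> //; rewrite /well_timed /lo /hi /=; lra.
  exists (c, (l, l + h)); split=> //; rewrite /well_timed /lo /hi /=; try lra.
  by split; [lra | split=> // E; lra].
have [->|w0] := eqVneq w [::].
  exists i0, [::]; split=> //=; first by rewrite i0c.
  by move=> j; rewrite inE => /eqP ->; split=> //; rewrite i0hi.
have [i [s [isw ips islast isall]]] := IH (l + h *+ 2) w0.
have ew : l + h *+ 2 + h *+ (size w).*2.-1 = l + h *+ (size (c :: w)).*2.-1.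
  rewrite -addrA -mulrnDr; congr (_ + _ *+ _).
  by case: (w) w0 => //= ? ? _; rewrite !doubleS /=; lia.
exists i0, (i :: s); split.
- by rewrite /= i0c -isw.
- rewrite /= ips andbT /before i0hi.
  by have [] := isall i (mem_head _ _); lra.
- by rewrite /= islast.
- move=> j; rewrite inE => /orP[/eqP ->|/isall[lj hj wj jh]].
    split=> //; rewrite i0hi -ew.
    by have : 0 <= h *+ (size w).*2.-1 by [exact: mulrn_wge0 (ltW h0)]; lra.
  by split=> //; [lra | rewrite -ew].
Qed.

(** The first letter is placed separately, because a vertex in this position must sit at the left
    end of its slot. With at least two letters there are at least three slots, so each slot is at
    most half of the interval. *)
Lemma layout (w : seq (set D * bool)) l r : (1 < size w)%N -> l < r ->
  exists i s, [/\ map fst (i :: s) = w, path before i s, lo i = l,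
    hi (last i s) = r &
    forall j, j \in i :: s -> [/\ l <= lo j, hi j <= r, well_timed j &
      (hi j - lo j) *+ 2 <= r - l]].
Proof.
case: w => [|c [|c' w]] // _ lr; set w' := c' :: w.
pose n := (size w').*2.+1; pose h := (r - l) / n%:R.
have n0 : (0 : R) < n%:R by rewrite ltr0n.
have h0 : 0 < h by rewrite divr_gt0 // subr_gt0.
have hn : h *+ n = r - l by rewrite -mulr_natr divfK // gt_eqF.
have h3 : h *+ 3 <= r - l.
  by rewrite -hn -2!(mulr_natr h) ler_pM2l // ler_nat /n /= !doubleS.
have [|i [s [isw ips islast isall]]] := @slots w' (l + h *+ 2) h h0; first by [].
have er : l + h *+ 2 + h *+ (size w').*2.-1 = r.
  by rewrite -addrA -mulrnDr -[r](subrKC l) -hn; congr (_ + _ *+ _).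
have [i0 [i0c i0lo i0hi iw]] : exists i0 : timed, [/\ i0.1 = c, lo i0 = l,
    hi i0 <= l + h & well_timed i0].
  have [sc|nsc] := pselect (single c.1).
    by exists (c, (l, l)); split=> //; rewrite /well_timed /lo /hi /=; lra.
  exists (c, (l, l + h)); split=> //; rewrite /well_timed /lo /hi /=.
  by split; [lra | split=> // E; lra].
exists i0, (i :: s); split=> //.
- by rewrite /= i0c -isw.
- by rewrite /= ips andbT /before; have [] := isall i (mem_head _ _); lra.
- by rewrite /= islast.
- move=> j; rewrite inE => /orP[/eqP ->|/isall[lj hj wj jh]].
    by split=> //; lra.
  by split=> //; lra.
Qed.

End TimedWords.

(** * Stages and their refinement *)

Section Stages.
Local Open Scope ring_scope.
Variables (R : realType) (D : digraph) (Dt : tournament D) (Ds : solid D).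
Variable v0 : D.
Local Notation timed := ((set D * bool) * (R * R))%type.
Implicit Types (i j : timed) (s : seq timed).

Definition start_item : timed := (vertex_item v0, (0, 0)).
Definition last_item : timed := (vertex_item v0, (1, 1)).

Definition stage s : Prop :=
  [/\ cyclic_word v0 (map fst s), path (@before R D) start_item s,
      last start_item s = last_item & forall i, i \in s -> well_timed i].

(** The second half keeps both end points of every interval as end points of items below it, so a
    gap between consecutive items remains the same at all later stages. *)
Definition refines s s' : Prop :=
  (forall j, j \in s' -> j \in s \/ exists2 i, i \in s &
     [/\ below j i, ~ single (iset i) & (hi j - lo j) *+ 2 <= hi i - lo i]) /\
  (forall i, i \in s -> (exists2 j, j \in s' & below j i /\ lo j = lo i) /\
     (exists2 j, j \in s' & below j i /\ hi j = hi i)).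

Definition vertices s : set D := lone (map fst s).

Lemma below_refl i : below i i.
Proof. by split. Qed.

Lemma below_trans j i i' : below i j -> below j i' -> below i i'.
Proof.
move=> [ij l h] [ji' l' h']; split; [exact: subset_trans ij ji'|..].
  exact: le_trans l' l.
exact: le_trans h h'.
Qed.

Lemma refines_refl s : refines s s.
Proof.
by split=> [j ? | i ?]; [left | split; exists i => //; split=> //; exact: below_refl].
Qed.

Lemma refines_trans s s' s'' : (forall i, i \in s' -> well_timed i) ->
  refines s s' -> refines s' s'' -> refines s s''.
Proof.
move=> wt [A B] [A' B']; split=> [j js''|i si].
  have [/A //|[i' i's' [ji' nsi' len]]] := A' j js''; right.
  have [is_|[i is_ [i'i nsi len']]] := A i' i's'; first by exists i'.
  exists i => //; split=> //; first exact: below_trans ji' i'i.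
  by have [le _] := wt i' i's'; lra.
have [[j js' [ji jl]] [k ks' [ki kh]]] := B i si.
have [[j' j's'' [j'j j'l]] _] := B' j js'; have [_ [k' k's'' [k'k k'h]]] := B' k ks'.
split; [exists j' => // | exists k' => //]; split; rewrite ?j'l ?k'h //.
  exact: below_trans j'j ji.
exact: below_trans k'k ki.
Qed.

Lemma lone_finite (w : seq (set D * bool)) : finite_set (lone w).
Proof.
elim: w => [|i w IH]; first by apply: (sub_finite_set _ (finite_set0 D)) => v [].
have [[v iv]|nsi] := pselect (single i.1).
  apply: (@sub_finite_set _ _ (v |` lone w)).
    move=> u [j]; rewrite inE => /orP[/eqP ->|jw ju]; last by right; exists j.
    rewrite iv => /seteqP[/(_ v erefl) vu _]; by left.
  by rewrite finite_setU; split=> //; exact: finite_set1.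
apply: sub_finite_set IH => u [j]; rewrite inE => /orP[/eqP ->|jw ju]; last by exists j.
by move=> iu; case: nsi; exists u.
Qed.

Lemma stage_item_comp s i : stage s -> i \in s -> ~ single (iset i) ->
  strong_component (vertices s) (iset i).
Proof.
move=> [[_ _ _ comps _] _ _ _] is_ nsi; have := comps i.1 (map_f _ is_) nsi.
by rewrite set0U.
Qed.

Lemma stage_item_neq0 s i : stage s -> i \in s -> iset i !=set0.
Proof.
move=> st is_; have [[v ->]|nsi] := pselect (single (iset i)); first by exists v.
by have [] := stage_item_comp st is_ nsi.
Qed.

Lemma stage_cover s v : stage s -> exists2 i, i \in s & iset i v.
Proof.
move=> [[_ _ /(_ v)]]; rewrite in_setT count_map => cnt _ _ _ _ _.
have /hasP[i is_ iv] : has (preim fst (fun i : set D * bool => v \in i.1)) s.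
  by rewrite has_count cnt.
by exists i => //; move: iv; rewrite /= inE.
Qed.

Lemma stage_inj s i j v : stage s -> i \in s -> j \in s -> iset i v -> iset j v ->
  i = j.
Proof.
move=> [[_ _ /(_ v)]]; rewrite in_setT count_map => cnt _ _ _ _ _ is_ js iv jv.
move: js cnt; case: (splitPr is_) => s1 s2; rewrite count_cat /= mem_cat inE.
rewrite [v \in _]mem_set // => js cnt.
have no t : j \in t -> (0 < count (preim fst (fun i : set D * bool => v \in i.1)) t)%N.
  by move=> jt; rewrite -has_count; apply/hasP; exists j => //=; rewrite inE.
move: cnt; rewrite addnCA add1n => -[/eqP]; rewrite addn_eq0 => /andP[/eqP c1 /eqP c2].
by case/or3P: js => [/no|/eqP //|/no]; rewrite ?c1 ?c2.
Qed.

Lemma refines_vertices s s' : stage s' -> refines s s' -> vertices s `<=` vertices s'.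
Proof.
move=> st' [_ B] v [_ /mapP[i is_ ->] iv].
have [[j js' [[ji _ _] _]] _] := B i is_.
exists j.1; first exact: map_f.
have [u ju] := stage_item_neq0 st' js'; have := ji u ju; rewrite /iset iv => uv.
apply/seteqP; split=> w; last by move=> ->; rewrite -uv.
by move=> /ji; rewrite /iset iv.
Qed.

Lemma stage_refine s i c : stage s -> i \in s -> ~ single (iset i) -> iset i c ->
  exists s', [/\ stage s', refines s s' & vertices s' c].
Proof.
move=> st is_ nsi ic; have hi_ := stage_item_comp st is_ nsi.
have [[Wp Wlast Wpart Wcomp W2] sp slast swt] := st.
have [s1 [s2 es]] : exists s1 s2, s = s1 ++ i :: s2.
  by case: (splitPr is_) => s1 s2; exists s1, s2.
(* The last item is the vertex [v0], hence [i] is not the last one and has a right neighbour. *)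
case: (lastP s2) es => [|s2' z] es.
  move: slast; rewrite es last_cat /= => ei.
  by case: nsi; exists v0; rewrite ei.
have ez : z = last_item by move: slast; rewrite es last_cat /= last_rcons.
have ew : map fst s = rcons (map fst s1 ++ i.1 :: map fst s2') (vertex_item v0).
  by rewrite es map_cat /= map_rcons rcons_cat ez.
move: (Wp); rewrite ew => /path_link_subst[b [ai ib subst]].
rewrite [i.1]surjective_pairing in ai ib.
have [w [wp [wpart wcomp wc w2]]] :=
  refine Dt Ds (lone_finite _) hi_ nsi ai ib ic.
have ilt : lo i < hi i.
  by have [le eqs] := swt i is_; rewrite lt_neqAle le andbT; apply/eqP => /eqs.
have [i1 [its [itsw itsp itslo itshi itsall]]] := layout w2 ilt.
pose s' := s1 ++ (i1 :: its) ++ rcons s2' z.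
have ew' : map fst s' = rcons (map fst s1 ++ w ++ map fst s2') (vertex_item v0).
  by rewrite !map_cat itsw map_rcons ez -!rcons_cat.
have W'part : partitions (map fst s') setT.
  move=> v; rewrite -Wpart ew ew' -!cats1 !count_cat /= wpart /iset.
  by rewrite !addnA.
have mem_s' j : j \in s' -> j \in i1 :: its \/ j \in s.
  rewrite es !mem_cat [j \in i :: _]inE => /or3P[-> |->|->]; rewrite ?orbT; by [right|left].
have s_mem j : j \in s -> j = i \/ j \in s'.
  rewrite es !mem_cat [j \in i :: _]inE => /or3P[->|/eqP ->|->]; rewrite ?orbT; by [right|left].
have below_i j : j \in i1 :: its -> below j i.
  move=> jits; have [l h _ _] := itsall j jits; split=> //.
  apply: (partitions_sub wpart); rewrite -itsw; exact: map_f.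
have sub : vertices s `<=` vertices s'.
  move=> v [_ /mapP[j js ->] jv]; exists j.1 => //; apply: map_f.
  by have [ji|//] := s_mem j js; case: nsi; exists v; rewrite -ji.
exists s'; split.
- split=> //.
  + split=> //.
    * by rewrite ew'; apply: subst.
    * by rewrite ew' last_rcons.
    * move=> k ks' nsk; move: (ks') => /mapP[j /mem_s'[jits|js] ek]; last first.
        apply: (comp_widen_lone (X := set0) (C := setT) (Y := vertices s)) => //.
        - by move=> v _ [].
        - by move=> v /sub; right.
        - by rewrite ek in nsk *; exact: stage_item_comp.
      have kw : k \in w by rewrite -itsw ek; exact: map_f.
      apply: (comp_widen_lone _ W'part ks' nsk _ (wcomp k kw nsk)).
        by move=> v _ [].
      move=> v [/sub|[l lw lv]]; [by right | right; exists l => //].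
      by rewrite ew' mem_rcons inE !mem_cat lw !orbT.
    * by rewrite ew' size_rcons !size_cat; lia.
  + move: sp; rewrite es /s' !cat_path /= => /and3P[-> si ip].
    rewrite itsp {1}/before itslo -/(before _ i) si /=.
    by move: ip; case: (s2') => [|? ?] /=; rewrite /before itshi.
  + by rewrite /s' !last_cat last_rcons ez.
  + by move=> j /mem_s'[/itsall[]|/swt].
- split=> j.
    move=> /mem_s'[jits|]; [right; exists i => // | by left].
    by split=> //; [exact: below_i | have [] := itsall j jits].
  move=> js; have [->|js'] := s_mem j js; last first.
    by split; exists j => //; split=> //; exact: below_refl.
  split.
    exists i1; first by rewrite !mem_cat mem_head orbT.
    by split=> //; apply: below_i; exact: mem_head.
  exists (last i1 its); first by rewrite !mem_cat mem_last orbT.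
  by split=> //; apply: below_i; exact: mem_last.
- case: wc => k kw kc; exists k => //.
  by rewrite ew' mem_rcons inE !mem_cat kw !orbT.
Qed.

Lemma stage_refine_seq s (cs : seq D) : stage s ->
  exists s', [/\ stage s', refines s s' & forall c, c \in cs -> vertices s' c].
Proof.
move=> st; elim: cs => [|c cs [s' [st' ss' cs']]].
  by exists s; split=> //; exact: refines_refl.
have [i is_ ic] := stage_cover c st'.
have [[v iv]|nsi] := pselect (single (iset i)).
  exists s'; split=> // u; rewrite inE => /orP[/eqP ->|/cs' //].
  exists i.1; first exact: map_f.
  by move: ic; rewrite -[i.1.1]/(iset i) iv => ->.
have [s'' [st'' ss'' c'']] := stage_refine st' is_ nsi ic.
exists s''; split=> //.
  by apply: refines_trans ss' ss''; case: st'.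
by move=> u; rewrite inE => /orP[/eqP -> //|/cs' /(refines_vertices st'' ss'')].
Qed.

(** Besides [c], one vertex [f i] of every item [i] is resolved. An item surviving unchanged is then
    a single vertex, so all other items have arisen by refinement and are at most half as long as
    their parents. *)
Lemma stage_next s c : stage s -> exists s', [/\ stage s', refines s s',
  vertices s' c & forall j, j \in s' -> ~ single (iset j) ->
    exists2 i, i \in s & [/\ below j i, ~ single (iset i) &
      (hi j - lo j) *+ 2 <= hi i - lo i]].
Proof.
move=> st; have [f fP] : exists f : timed -> D, forall i, i \in s -> iset i (f i).
  have /choice[f fP] : forall i, exists v, i \in s -> iset i v.
    move=> i; have [is_|nis] := boolP (i \in s); last by exists v0.
    by have [v iv] := stage_item_neq0 st is_; exists v.
  by exists f.
have [s' [st' ss' all']] := stage_refine_seq (c :: map f s) st.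
exists s'; split=> //; first by apply: all'; exact: mem_head.
move=> j js' nsj; have [js|//] := ss'.1 j js'.
have [k ks' kf] : vertices s' (f j) by apply: all'; rewrite inE map_f ?orbT.
case: nsj; exists (f j); move: ks' => /mapP[k' k's' ek]; rewrite -kf ek.
congr iset; apply: stage_inj st' js' k's' (fP j js) _.
by rewrite /iset -ek kf.
Qed.

Lemma first_stage W : cyclic_word v0 W -> exists s, stage s.
Proof.
move=> [Wp Wlast Wpart Wcomp W2].
have [||i [s [isw ip ilo shi isall]]] := @layout R D (vertex_item v0 :: W) 0 1.
- by rewrite /= ltnS; apply: ltnW.
- exact: ltr01.
have v1 : single [set v0] by exists v0.
case: isw => i0 sW.
exists s; rewrite /stage sW; split=> //.
- have [_ _ [_ eqs] _] := isall i (mem_head _ _).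
  rewrite (_ : start_item = i) // [i]surjective_pairing [i.2]surjective_pairing i0.
  have E : lo i = hi i by apply: (proj2 eqs); rewrite /iset i0; exact: v1.
  by congr (_, (_, _)); [rewrite -ilo | rewrite -ilo E].
- have sl : (last i s).1 = vertex_item v0.
    by rewrite -Wlast -sW -i0 last_map.
  have [_ _ [_ eqs] _] := isall _ (mem_last i s).
  have E : lo (last i s) = hi (last i s) by apply: (proj2 eqs); rewrite /iset sl; exact: v1.
  have -> : last start_item s = last i s by case: (s) sW => [|//] eW; rewrite -eW in W2.
  rewrite [last i s]surjective_pairing [(last i s).2]surjective_pairing sl.
  by congr (_, (_, _)); [rewrite -shi -E | rewrite -shi].
- by move=> j js; have [] := isall j; rewrite ?inE ?js ?orbT.
Qed.

End Stages.

(** * The order of the items of a stage in time *)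

Section StageOrder.
Local Open Scope ring_scope.
Variables (R : realType) (D : digraph) (v0 : D).
Local Notation timed := ((set D * bool) * (R * R))%type.
Implicit Types (i j k : timed) (s : seq timed) (t : R).

(* The word of a stage starts and ends with [v0], at times 0 and 1. *)
Definition line s : seq timed := start_item R v0 :: s.

Lemma line_well_timed s i : stage v0 s -> i \in line s -> well_timed i.
Proof.
move=> [_ _ _ wt]; rewrite inE => /orP[/eqP ->|/wt //].
by split=> //; split=> // _; exists v0.
Qed.

Lemma line_pairwise s : stage v0 s -> pairwise (@before R D) (line s).
Proof.
move=> st; have [_ sp _ _] := st.
(* [before] is transitive only through items with [lo <= hi]. *)
rewrite -(path_pairwise_in (P := [pred i | `[< well_timed i >]])) //.
  move=> j i k /asboolP[jw _] _ _; rewrite /before; lra.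
by apply/allP => i /(line_well_timed st) iw; exact/asboolP.
Qed.

Lemma line_last s : stage v0 s -> last_item R v0 \in s.
Proof.
move=> [[_ _ _ _]]; rewrite size_map; case: s => // i s _ _ <- _ /=.
exact: mem_last.
Qed.

Lemma line_consecutive s s1 i j s2 k : stage v0 s -> line s = s1 ++ i :: j :: s2 ->
  k \in line s -> hi k <= hi i \/ lo j <= lo k.
Proof.
move=> st es ks; have := line_pairwise st; rewrite es pairwise_cat.
have wt l : l \in line s -> lo l <= hi l by move=> /(line_well_timed st)[].
move=> /and3P[/allrelP a _ /= /andP[_ /andP[/allP c _]]].
have il : i \in line s by rewrite es mem_cat mem_head orbT.
have jl : j \in line s by rewrite es mem_cat !inE eqxx !orbT.
move: (ks); rewrite es mem_cat !inE => /or4P[k1|/eqP ->|/eqP ->|k2].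
- left; have := a k i k1 (mem_head _ _); have := wt i il; rewrite /before; lra.
- by left.
- by right.
- right; have := c k k2; have := wt j jl; rewrite /before; lra.
Qed.

Lemma line_disjoint s i j t : stage v0 s -> i \in line s -> j \in line s ->
  lo i <= t <= hi i -> lo j <= t <= hi j -> i = j.
Proof.
move=> st; have := line_pairwise st; elim: (line s) => //= k r IH.
move=> /andP[/allP kr rp]; rewrite !inE => /orP[/eqP ->|ir] /orP[/eqP ->|jr] ti tj //.
- exfalso; have := kr j jr; rewrite /before; lra.
- exfalso; have := kr i ir; rewrite /before; lra.
- exact: IH.
Qed.

Lemma line_bounds s i : stage v0 s -> i \in line s -> [/\ 0 <= lo i, lo i <= hi i & hi i <= 1].
Proof.
move=> st il; have := line_pairwise st; have [le _] := line_well_timed st il.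
have [_ _ sl _] := st.
case: (lastP s) sl il => [/(congr1 (@hi R D)) /=|s' z]; first by rewrite /hi /=; lra.
rewrite last_rcons => ->; rewrite /line -rcons_cons pairwise_rcons => il.
move=> /andP[/allP zl /= /andP[/allP fl _]]; split=> //.
  move: il; rewrite mem_rcons !inE => /or3P[/eqP ->|/eqP ->|/fl]; rewrite /before /lo /hi /=; lra.
move: il; rewrite mem_rcons inE => /orP[/eqP -> //|/zl]; rewrite /before /hi /lo /=; lra.
Qed.

Lemma line_linked s s1 i j s2 : stage v0 s -> line s = s1 ++ i :: j :: s2 ->
  linked i.1 j.1.
Proof.
move=> [[+ _ _ _ _] _ _ _] es; rewrite -/(path link (vertex_item v0) (map fst s)).
have -> : path link (vertex_item v0) (map fst s) = sorted link (map fst (line s)) by [].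
rewrite es map_cat /=; elim: s1 {es} => [|k s1 IH] /=; first by move=> /andP[/asboolP].
move=> /path_sorted; exact: IH.
Qed.

Lemma line_gap s t : stage v0 s -> 0 <= t <= 1 ->
  (exists2 i, i \in line s & lo i <= t <= hi i) \/
  exists s1 i j s2, line s = s1 ++ i :: j :: s2 /\ hi i < t < lo j.
Proof.
move=> st /andP[t0 t1]; have [_ _ sl _] := st.
have : t <= hi (last (start_item R v0) s) by rewrite sl.
have : lo (start_item R v0) <= t by [].
rewrite /line; elim: s (start_item R v0) {st sl} => [|j s IH] i /= it til.
  by left; exists i; rewrite ?mem_head ?it.
have [tj|jt] := ltP t (lo j).
  have [ti|ti] := leP t (hi i).
    by left; exists i; rewrite ?mem_head ?it.
  by right; exists [::], i, j, s; rewrite ti tj.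
have [[k ks kt]|[s1 [k [l [s2 [es kl]]]]]] := IH j jt til.
  by left; exists k => //; rewrite inE ks orbT.
by right; exists (i :: s1), k, l, s2; rewrite es.
Qed.

Lemma line_next s i : stage v0 s -> i \in line s -> hi i < 1 ->
  exists s1 j s2, line s = s1 ++ i :: j :: s2.
Proof.
move=> st il i1; have [_ _ sl _] := st.
have [s1 [s2 es]] : exists s1 s2, line s = s1 ++ i :: s2.
  by case: (splitPr il) => s1 s2; exists s1, s2.
case: s2 es => [|j s2] es; last by exists s1, j, s2.
have : last i (line s) = last_item R v0 by rewrite /= sl.
by rewrite es last_cat /= => ei; move: i1; rewrite ei ltxx.
Qed.

Lemma line_prev s i : stage v0 s -> i \in line s -> 0 < lo i ->
  exists s1 j s2, line s = s1 ++ j :: i :: s2.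
Proof.
move=> st il i0.
have [s1 [s2 es]] : exists s1 s2, line s = s1 ++ i :: s2.
  by case: (splitPr il) => s1 s2; exists s1, s2.
case: (lastP s1) es => [[ei _]|s1' j ->]; first by move: i0; rewrite -ei ltxx.
by exists s1', j, s2; rewrite cat_rcons.
Qed.

End StageOrder.

(** * The limit of the words *)

Section Resolution.
Local Open Scope ring_scope.
Variables (R : realType) (D : digraph).
Local Notation timed := ((set D * bool) * (R * R))%type.

(** The bound 1/(n+1) on the lengths is weaker than what halving gives, but it tends to 0 and is
    kept by induction, as n + 2 is at most 2(n + 1). *)
Definition resolution v0 (st : nat -> seq timed) : Prop :=
  [/\ forall n, stage v0 (st n), forall n, refines (st n) (st n.+1),
      forall v, exists n, vertices (st n) v &
      forall n j, j \in st n -> ~ single (iset j) -> (hi j - lo j) *+ n.+1 <= 1].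

(** [stage_next] is iterated along an enumeration [f] of the vertices; the iterated state carries
    the index of the next vertex together with the stage. *)
Lemma resolution_exists : tournament D -> solid D -> strongly_connected [set: D] ->
  [set: D] #= [set: nat] -> exists v0 st, resolution v0 st.
Proof.
move=> Dt Ds Dstrong Dcount.
have Dinf : infinite_set [set: D].
  by move=> fD; apply: infinite_nat; rewrite -(eq_finite_set Dcount).
have [v0 [W cW]] := cyclic_word_exists Dt Ds Dinf Dstrong.
have [s0 st0] := first_stage R cW.
have [f fsurj] : exists f : nat -> D, forall v, exists n, f n = v.
  have /card_set_bijP[g [_ ginj _]] := Dcount.
  have /choice[f fP] : forall n, exists v, forall u, g u = n -> v = u.
    move=> n; have [[u gu]|none] := pselect (exists u, g u = n).
      by exists u => u' gu'; apply: ginj; rewrite ?inE // gu gu'.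
    by exists v0 => u gu; case: none; exists u.
  by exists f => v; exists (g v); exact: fP.
have : forall ns : nat * {s : seq timed | stage v0 s},
    exists ns' : nat * {s : seq timed | stage v0 s},
    [/\ ns'.1 = ns.1.+1, refines (sval ns.2) (sval ns'.2),
      vertices (sval ns'.2) (f ns.1) & forall j : timed, j \in sval ns'.2 ->
    ~ single (iset j) -> exists2 i, i \in sval ns.2 & [/\ below j i,
      ~ single (iset i) & (hi j - lo j) *+ 2 <= hi i - lo i]].
  move=> [n [s st]]; have [s' [st' ss' c' short]] := stage_next Dt Ds (f n) st.
  by exists (n.+1, exist _ s' st').
move=> /choice[g gP]; pose h n := iter n g (0%N, exist _ s0 st0).
have hn n : (h n).1 = n by elim: n => // n IH; have [-> _ _ _] := gP (h n); rewrite IH.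
have hS n := gP (h n).
exists v0, (fun n => sval (h n).2); split.
- by move=> n; exact: svalP.
- by move=> n; have [] := hS n.
- move=> v; have [n <-] := fsurj v; exists n.+1.
  by have [_ _ + _] := hS n; rewrite hn.
- elim=> [|n IH] j js nsj.
    have [j0 _ j1] := @line_bounds R D v0 s0 j st0 (@mem_behead _ (line v0 s0) _ js).
    by rewrite mulr1n; lra.
  have [_ _ _ short] := hS n; have [i is_ [ji nsi len]] := short j js nsj.
  have := IH i is_ nsi; apply: le_trans.
  have le : 0 <= hi j - lo j.
    have [] := line_bounds (svalP (h n.+1).2) (@mem_behead _ (line v0 _) _ js); lra.
  apply: le_trans (ler_wMn2r n.+1 len); rewrite -mulrnA -!(mulr_natr (_ - _)).
  by apply: ler_wpM2l => //; rewrite ler_nat; lia.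
Qed.

End Resolution.

(** * Times of vertices and ends, and the gaps between them *)

Section NodeTimes.
Local Open Scope ring_scope.
Variables (R : realType) (D : digraph) (v0 : D).
Local Notation timed := ((set D * bool) * (R * R))%type.
Variable st : nat -> seq timed.
Hypothesis stP : resolution v0 st.
Implicit Types (i j k : timed) (t : R) (v : D) (w : ends D) (p q : node D).

Let stS n : stage v0 (st n).
Proof. by have [] := stP. Qed.

Let X n : set D := vertices (st n).
Let L n := line v0 (st n).
Let at_ i t := lo i <= t <= hi i.

(** These times stay inside the items of all stages. All other times in [0,1] lie in gaps and will
    be spent on edges and limit edges. *)
Definition node_time t : Prop := forall n, exists2 i, i \in L n & at_ i t.

Definition node_at t p : Prop :=
  match p with
  | inl v => exists n, exists2 i, i \in L n & [/\ iset i = [set v], lo i = t & hi i = t]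
  | inr w => forall n, exists2 i, i \in L n &
      [/\ at_ i t, ~ single (iset i) & end_comp (X n) w = iset i]
  end.

Lemma X_finite n : finite_set (X n).
Proof. exact: lone_finite. Qed.

Lemma X_mono m n : (m <= n)%N -> X m `<=` X n.
Proof.
move=> mn; rewrite -(subnK mn); elim: (n - m)%N => // k IH.
apply: subset_trans IH _; rewrite addSn; apply: refines_vertices => //.
by have [] := stP.
Qed.

Lemma X_exhaust Y : finite_set Y -> exists n, Y `<=` X n.
Proof.
move=> /finite_seqP[s ->]; elim: s => [|v s [n sn]]; first by exists 0%N.
have [_ _ /(_ v)[m vm] _] := stP; exists (maxn m n) => w /=; rewrite inE => /orP[/eqP ->|ws].
  by apply: X_mono vm; exact: leq_maxl.
by apply: (X_mono (leq_maxr m n)); exact: sn.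
Qed.

Lemma line_below m n i : (m <= n)%N -> i \in L n -> exists2 j, j \in L m & below i j.
Proof.
move=> mn; rewrite -(subnK mn); elim: (n - m)%N i => [i ?|k IH i].
  by exists i => //; exact: below_refl.
rewrite addSn inE => /orP[/eqP ->|is_].
  by exists (start_item R v0); [exact: mem_head | exact: below_refl].
have [_ /(_ (k + m)%N)[A _] _ _] := stP.
have [i' i'L ii'] : exists2 i', i' \in L (k + m)%N & below i i'.
  have [is'|[i' i's [ii' _ _]]] := A i is_.
    by exists i; [rewrite inE is' orbT | exact: below_refl].
  by exists i' => //; rewrite inE i's orbT.
have [j jL i'j] := IH i' i'L; exists j => //; exact: below_trans ii' i'j.
Qed.

Lemma below_at i j t : below i j -> at_ i t -> at_ j t.
Proof. by move=> [_ l h]; rewrite /at_; lra. Qed.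

Lemma line_lo_persists m n i : (m <= n)%N -> i \in L m ->
  exists2 j, j \in L n & below j i /\ lo j = lo i.
Proof.
move=> mn iL; rewrite -(subnK mn); elim: (n - m)%N => [|k [j jL [ji jl]]].
  by exists i => //; split=> //; exact: below_refl.
rewrite addSn; move: jL; rewrite inE => /orP[/eqP ej|js].
  exists (start_item R v0); first exact: mem_head.
  by rewrite -ej.
have [_ /(_ (k + m)%N)[_ B] _ _] := stP; have [[j' j's [j'j j'l]] _] := B j js.
exists j'; first by rewrite inE j's orbT.
by rewrite j'l; split=> //; exact: below_trans j'j ji.
Qed.

Lemma line_hi_persists m n i : (m <= n)%N -> i \in L m ->
  exists2 j, j \in L n & below j i /\ hi j = hi i.
Proof.
move=> mn iL; rewrite -(subnK mn); elim: (n - m)%N => [|k [j jL [ji jh]]].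
  by exists i => //; split=> //; exact: below_refl.
rewrite addSn; move: jL; rewrite inE => /orP[/eqP ej|js].
  exists (start_item R v0); first exact: mem_head.
  by rewrite -ej.
have [_ /(_ (k + m)%N)[_ B] _ _] := stP; have [_ [j' j's [j'j j'h]]] := B j js.
exists j'; first by rewrite inE j's orbT.
by rewrite j'h; split=> //; exact: below_trans j'j ji.
Qed.

Lemma node_time_lo n i : i \in L n -> node_time (lo i).
Proof.
move=> iL m; have le j : j \in L m -> lo j <= hi j by move=> /(line_bounds (stS m))[].
have [mn|nm] := leqP m n.
  have [j jL ij] := line_below mn iL; exists j => //; apply: below_at ij _.
  by have [] := line_bounds (stS n) iL; rewrite /at_; lra.
have [j jL [_ jl]] := line_lo_persists (ltnW nm) iL; exists j => //.
by rewrite /at_ -jl lexx le.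
Qed.

Lemma node_time_hi n i : i \in L n -> node_time (hi i).
Proof.
move=> iL m; have le j : j \in L m -> lo j <= hi j by move=> /(line_bounds (stS m))[].
have [mn|nm] := leqP m n.
  have [j jL ij] := line_below mn iL; exists j => //; apply: below_at ij _.
  by have [] := line_bounds (stS n) iL; rewrite /at_; lra.
have [j jL [_ jh]] := line_hi_persists (ltnW nm) iL; exists j => //.
by rewrite /at_ -jh lexx le.
Qed.

Lemma node_time_bounds t : node_time t -> 0 <= t <= 1.
Proof.
by move=> /(_ 0%N)[i iL]; have [] := line_bounds (stS 0%N) iL; rewrite /at_; lra.
Qed.

Lemma line_neq0 n i : i \in L n -> iset i !=set0.
Proof.
rewrite inE => /orP[/eqP ->|is_]; first by exists v0.
exact: stage_item_neq0 is_.
Qed.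

Lemma line_nonsingle n i : i \in L n -> ~ single (iset i) -> i \in st n.
Proof. by rewrite inE => /orP[/eqP ->|//]; case; exists v0. Qed.

(** If no item containing [t] is a single vertex, these items form a decreasing sequence of
    components, and [nested_components_end] provides the end. *)
Lemma node_time_exists t : node_time t -> exists p, node_at t p.
Proof.
move=> tT; have [[n [i [iL it [v iv]]]]|ns] :=
  pselect (exists n, exists i, [/\ i \in L n, at_ i t & single (iset i)]).
  exists (inl v); exists n, i => //; split=> //.
    have [_ [_ eqs]] := line_well_timed (stS n) iL.
    by move: it; rewrite /at_ eqs; [lra | exists v].
  have [_ [_ eqs]] := line_well_timed (stS n) iL.
  by move: it; rewrite /at_ eqs; [lra | exists v].
have /choice[f fP] : forall n, exists i, i \in L n /\ at_ i t.
  by move=> n; have [i iL it] := tT n; exists i.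
have nsf n : ~ single (iset (f n)).
  by have [fL ft] := fP n; move=> sf; apply: ns; exists n, (f n).
have [|||||w wC] := @nested_components_end D X (fun n => iset (f n)).
- exact: X_finite.
- exact: X_mono.
- by move=> v; have [n Xn] := X_exhaust (finite_set1 v); exists n; exact: Xn.
- move=> n; apply: (stage_item_comp (stS n)) (nsf n); apply: line_nonsingle => //.
  by have [] := fP n.
- move=> m n mn; have [fm mt] := fP m; have [fn nt] := fP n.
  have [j jL fj] := line_below mn fn.
  rewrite (line_disjoint (stS m) fm jL mt (below_at fj nt)).
  by have [] := fj.
by exists (inr w) => n; have [fL ft] := fP n; exists (f n).
Qed.

Lemma node_at_vertex_persists t v m n i : (m <= n)%N -> i \in L m ->
  iset i = [set v] -> lo i = t -> hi i = t ->
  exists2 j, j \in L n & [/\ iset j = [set v], lo j = t & hi j = t].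
Proof.
move=> mn iL iv il ih; have [j jL [[ji l h] jl]] := line_lo_persists mn iL.
exists j => //; have [u ju] := line_neq0 jL.
have [_ le _] := line_bounds (stS n) jL; split; [|lra|lra].
have := ji u ju; rewrite iv => uv; apply/seteqP; split=> w; last by move=> ->; rewrite -uv.
by move=> /ji; rewrite iv.
Qed.

(** The set at which, by the definition of limit edges, an edge standing for an arc at [p] has to
    begin or end once [Y] is deleted. *)
Definition shadow (Y : set D) p : set D :=
  match p with inl v => [set v] | inr w => end_comp Y w end.

Lemma node_at_shadow t p Y : finite_set Y -> node_at t p ->
  exists N, forall n i, (N <= n)%N -> i \in L n -> at_ i t -> iset i `<=` shadow Y p.
Proof.
move=> fY; case: p => [v [N [j jL [jv jl jh]]]|w tw].
  exists N => n i Nn iL it; have [k kL [kv kl kh]] := node_at_vertex_persists Nn jL jv jl jh.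
  have kt : at_ k t by rewrite /at_ kl kh lexx.
  by rewrite (line_disjoint (stS n) iL kL it kt) kv.
have [N YN] := X_exhaust fY; exists N => n i Nn iL it.
have [k kL [kt _ ek]] := tw n.
rewrite (line_disjoint (stS n) iL kL it kt) -ek; apply: end_comp_sub => //.
- exact: X_finite.
- exact: subset_trans YN (X_mono Nn).
Qed.

(** At stage n both times lie in the one item that equals the component of [w], and its length is at
    most 1/(n+1). The index [Num.bound] of the inverse distance makes this too short. *)
Lemma node_at_end_inj t t' w : node_at t (inr w) -> node_at t' (inr w) -> t = t'.
Proof.
have small u u' : node_at u (inr w) -> node_at u' (inr w) -> u <= u'.
  move=> uw u'w; rewrite leNgt; apply/negP => lt.
  have n1 : 1 < (u - u') *+ (Num.bound (u - u')^-1).+1.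
    have d0 : 0 < u - u' by rewrite subr_gt0.
    rewrite -mulr_natr mulrC -ltr_pdivrMr // mul1r.
    apply: lt_trans (archi_boundP _) _; first by rewrite invr_ge0 ltW.
    by rewrite ltr_nat.
  move: n1; set n := Num.bound _.
  have [i iL [it nsi ei]] := uw n; have [j jL [jt nsj ej]] := u'w n.
  have ij : i = j.
    have [v iv] := line_neq0 iL; apply: (stage_inj (stS n) _ _ iv).
    - exact: line_nonsingle.
    - exact: line_nonsingle.
    - by rewrite -ej ei.
  have [_ _ _ /(_ n i (line_nonsingle iL nsi) nsi) len] := stP.
  have : (u - u') *+ n.+1 <= (hi i - lo i) *+ n.+1.
    by apply: ler_wMn2r; move: it jt; rewrite -ij /at_; lra.
  lra.
by move=> tw t'w; apply/eqP; rewrite eq_le !small.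
Qed.

(** The vertex [v0] is visited at time 0 and again at time 1, whence the two bounds; within a stage
    proper, equal items follow from [stage_inj]. *)
Lemma node_at_inj t t' p : t < 1 -> t' < 1 -> node_at t p -> node_at t' p -> t = t'.
Proof.
move=> t1 t'1; case: p => [v|w]; last exact: node_at_end_inj.
move=> [m [i iL [iv il ih]]] [m' [i' i'L [i'v i'l i'h]]].
have [j jL [jv jl jh]] := node_at_vertex_persists (leq_maxl m m') iL iv il ih.
have [j' j'L [j'v j'l j'h]] := node_at_vertex_persists (leq_maxr m m') i'L i'v i'l i'h.
set n := maxn m m' in jL j'L; have lastL := line_last (stS n).
have nstart k k' : k \in L n -> k' \in L n -> iset k = [set v] -> iset k' = [set v] ->
    hi k' < 1 -> k = start_item R v0 -> k' = start_item R v0.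
  move=> kL + kv k'v k'1 ek; rewrite inE => /orP[/eqP //|k's].
  have k'v0 : iset k' v0 by rewrite k'v -kv ek.
  have ek' := stage_inj (stS n) k's lastL k'v0 (erefl v0).
  by move: k'1; rewrite ek' ltxx.
have [ej|nj] := eqVneq j (start_item R v0).
  by rewrite -jl -j'l ej (nstart j j') ?j'h.
have [ej'|nj'] := eqVneq j' (start_item R v0).
  by rewrite -jl -j'l ej' (nstart j' j) ?jh.
have js : j \in st n by move: jL; rewrite inE (negbTE nj).
have j's : j' \in st n by move: j'L; rewrite inE (negbTE nj').
have jv' : iset j v by rewrite jv.
have j'v' : iset j' v by rewrite j'v.
by rewrite -jl -j'l (stage_inj (stS n) js j's jv' j'v').
Qed.

Definition gap a b : Prop :=
  [/\ node_time a, node_time b, a < b & forall t, a < t < b -> ~ node_time t].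

Lemma gap_exists t : 0 <= t <= 1 -> ~ node_time t -> exists a b, gap a b /\ a < t < b.
Proof.
move=> t01 /existsNP[n nt].
have [[i iL it]|[s1 [i [j [s2 [es tij]]]]]] := line_gap (stS n) t01.
  by case: nt; exists i.
have iL : i \in L n by rewrite /L es mem_cat mem_head orbT.
have jL : j \in L n by rewrite /L es mem_cat !inE eqxx !orbT.
exists (hi i), (lo j); split=> //; split; [exact: node_time_hi iL|exact: node_time_lo jL|lra|].
move=> u uij /(_ n)[k kL ku].
by have [] := line_consecutive (stS n) es kL; move: ku; rewrite /at_; lra.
Qed.

Lemma gap_unique a b a' b' t : gap a b -> gap a' b' -> a < t < b -> a' < t < b' ->
  a = a' /\ b = b'.
Proof.
move=> [aT bT _ ab] [a'T b'T _ ab'] t1 t2; split.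
  case: (ltgtP a a') => // lt; last by case: (ab' a) => //; lra.
  by case: (ab a') => //; lra.
case: (ltgtP b b') => // lt; last by case: (ab b') => //; lra.
by case: (ab' b) => //; lra.
Qed.

(** The midpoint of the gap is uncovered at some stage and so at all later ones. The items on its
    two sides end exactly at [a] and begin exactly at [b], because end points of items are node
    times and the gap has none inside. *)
Lemma gap_linked a b : gap a b -> exists N, forall n, (N <= n)%N -> exists i j,
  [/\ i \in L n, j \in L n, hi i = a, lo j = b & linked i.1 j.1].
Proof.
move=> [aT bT lt ab]; pose t := (a + b) / 2%:R.
have tab : a < t < b by rewrite /t; lra.
have /existsNP[N nt] := ab t tab.
have a0 := node_time_bounds aT; have b0 := node_time_bounds bT.
exists N => n Nn; have [|[i iL it]|[s1 [i [j [s2 [es tij]]]]]] := @line_gap _ _ v0 (st n) t (stS n).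
- lra.
- have [k kL ik] := line_below Nn iL; case: nt; exists k => //; exact: below_at ik it.
have iL : i \in L n by rewrite /L es mem_cat mem_head orbT.
have jL : j \in L n by rewrite /L es mem_cat !inE eqxx !orbT.
exists i, j; split=> //; last exact: line_linked es.
  have [k kL ka] := aT n; apply/eqP; rewrite eq_le; apply/andP; split.
    rewrite leNgt; apply/negP => ai; apply: (ab (hi i)); first by lra.
    exact: node_time_hi iL.
  by have [] := line_consecutive (stS n) es kL; move: ka; rewrite /at_; lra.
have [k kL kb] := bT n; apply/eqP; rewrite eq_le; apply/andP; split.
  by have [] := line_consecutive (stS n) es kL; move: kb; rewrite /at_; lra.
rewrite leNgt; apply/negP => bj; apply: (ab (lo j)); first by lra.
exact: node_time_lo jL.
Qed.

Lemma gap_shadow a b p q Y : gap a b -> node_at a p -> node_at b q -> finite_set Y ->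
  edge_between (shadow Y p) (shadow Y q).
Proof.
move=> gab ap bq fY; have [N1 NP] := gap_linked gab.
have [N2 N2P] := node_at_shadow fY ap; have [N3 N3P] := node_at_shadow fY bq.
pose n := maxn N1 (maxn N2 N3).
have [|i [j [iL jL ia jb [[u [v [iu jv uv]]] _ _ _]]]] := NP n; first by rewrite leq_maxl.
have [_ ile _] := line_bounds (stS n) iL; have [_ jle _] := line_bounds (stS n) jL.
exists u, v; split=> //.
  apply: (N2P n i) iu => //; last by rewrite /at_ -ia lexx ile.
  by rewrite /n maxnCA leq_maxl.
apply: (N3P n j) jv => //; last by rewrite /at_ -jb lexx jle.
by rewrite /n maxnA leq_maxr.
Qed.

(** Each kind of arc asks for edges between shadows, which [gap_shadow] gives for every finite [Y].
    That the two ends of a limit edge differ comes from [node_at_end_inj]. *)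
Lemma gap_arc a b p q : gap a b -> node_at a p -> node_at b q -> is_arc p q.
Proof.
move=> gab ap bq; have sh Y := gap_shadow gab ap bq (Y := Y).
case: p q ap bq sh => [u|w] [v|h] ap bq sh /=.
- by have [_ [_ [-> -> uv]]] := sh set0 (finite_set0 _).
- by move=> Y fY _; exact: sh.
- by move=> Y fY _; exact: sh.
split=> [wh|Y [fY _]]; last exact: sh.
by have [_ _ + _] := gab; rewrite wh in ap; rewrite (node_at_end_inj ap bq) ltxx.
Qed.

Lemma gap_right n i : i \in L n -> hi i < 1 -> exists b, gap (hi i) b.
Proof.
move=> iL i1; have [s1 [j [s2 es]]] := line_next (stS n) iL i1.
have jL : j \in L n by rewrite /L es mem_cat !inE eqxx !orbT.
exists (lo j); split; [exact: node_time_hi iL | exact: node_time_lo jL | |].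
  have := line_pairwise (stS n); rewrite es pairwise_cat.
  by move=> /and3P[_ _ /= /andP[/andP[+ _] _]].
move=> t tij /(_ n)[k kL kt].
by have [] := line_consecutive (stS n) es kL; move: kt; rewrite /at_; lra.
Qed.

Lemma gap_left n i : i \in L n -> 0 < lo i -> exists a, gap a (lo i).
Proof.
move=> iL i0; have [s1 [j [s2 es]]] := line_prev (stS n) iL i0.
have jL : j \in L n by rewrite /L es mem_cat mem_head orbT.
exists (hi j); split; [exact: node_time_hi jL | exact: node_time_lo iL | |].
  have := line_pairwise (stS n); rewrite es pairwise_cat.
  by move=> /and3P[_ _ /= /andP[/andP[+ _] _]].
move=> t tij /(_ n)[k kL kt].
by have [] := line_consecutive (stS n) es kL; move: kt; rewrite /at_; lra.
Qed.

End NodeTimes.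

(** * The space of vertices, ends and arcs *)

Section EndSpace.
Local Open Scope ring_scope.
Variables (R : realType) (D : digraph).
Implicit Types (U : set (end_space R D)) (e : darc D) (z : R).

(** The basic sets serve as a subbase, and a filter is stable under the finite intersections that
    generate the neighbourhoods. *)
Lemma cvg_end_space (F : set_system (end_space R D)) (x : end_space R D) :
  Filter F -> (forall U, basic_open U -> U x -> F U) -> F --> x.
Proof.
move=> FF cF A /=; rewrite nbhsE => -[_ [[B sB <-] [C BC Cx]] sUBA].
rewrite nbhs_filterE; apply: filterS sUBA _; apply: (@filterS _ _ _ C).
  by move=> ? ?; exists C.
have /sB[G sG IGeC] := BC; rewrite -IGeC; apply: filter_bigI => E EG.
have /sG := EG; rewrite inE => bE; apply: cF => //.
by move: Cx; rewrite -IGeC => /(_ _ EG).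
Qed.

Lemma darc_inj e f : arc_tail e = arc_tail f -> arc_head e = arc_head f -> e = f.
Proof.
case: e f => [p q pq] [p' q' pq'] /= pp' qq'.
by move: pq pq'; rewrite pp' qq' => pq pq'; rewrite (Prop_irrelevance pq pq').
Qed.

Lemma arc_point0 e : arc_point e 0 = Node (arc_tail e) :> end_space R D.
Proof. by rewrite /arc_point insubF ?lexx // ltxx. Qed.

Lemma arc_point1 e : arc_point e 1 = Node (arc_head e) :> end_space R D.
Proof. by rewrite /arc_point insubF ?ltxx ?andbF // leNgt ltr01. Qed.

Lemma arc_point_inner e (t : {t : R | 0 < t < 1}) : arc_point e (sval t) = Inner e t.
Proof. by rewrite /arc_point (valK t). Qed.

Lemma arc_pointP e z : 0 <= z <= 1 ->
  [\/ z = 0, z = 1 | exists t : {t : R | 0 < t < 1}, sval t = z].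
Proof.
move=> /andP[z0 z1]; have [->|nz0] := eqVneq z 0; first exact: Or31.
have [->|nz1] := eqVneq z 1; first exact: Or32.
have zi : 0 < z < 1 by rewrite !lt_neqAle eq_sym nz0 nz1 z0 z1.
by apply: Or33; exists (exist _ z zi).
Qed.

Lemma basic_open_inner U e (t : {t : R | 0 < t < 1}) : basic_open U -> U (Inner e t) ->
  exists2 d, 0 < d & forall t' : {t : R | 0 < t < 1},
    `|sval t' - sval t| < d -> U (Inner e t').
Proof.
case=> [v eps _|f a b _ _ _ _|X w eps _ _|X w h z eps _ _ _|X v w z eps _ _ _ _
  |X w v z eps _ _ _ _] /=.
- case=> [[te lt]|[he lt]].
    exists (eps - sval t); first by rewrite subr_gt0.
    by move=> t'; rewrite ltr_distl => /andP[? ?]; left; split=> //; lra.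
  exists (sval t - (1 - eps)); first by rewrite subr_gt0.
  by move=> t'; rewrite ltr_distl => /andP[? ?]; right; split=> //; lra.
- move=> [ef /andP[at_ tb]]; exists (Num.min (sval t - a) (b - sval t)).
    by rewrite lt_min !subr_gt0 at_.
  by move=> t'; rewrite lt_min !ltr_distl => /andP[/andP[? ?] /andP[? ?]]; split=> //; lra.
- case=> [[te he]|[te he lt]|[te he lt]].
  + by exists 1 => // t' _; apply: Or31.
  + exists (eps - sval t); first by rewrite subr_gt0.
    by move=> t'; rewrite ltr_distl => /andP[? ?]; apply: Or32; split=> //; lra.
  + exists (sval t - (1 - eps)); first by rewrite subr_gt0.
    by move=> t'; rewrite ltr_distl => /andP[? ?]; apply: Or33; split=> //; lra.
all: move=> [te he lt]; exists (eps - `|sval t - z|); first by rewrite subr_gt0.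
all: by move=> t' tt'; split=> //; have := ler_distD (sval t) (sval t') z; lra.
Qed.

Lemma basic_open_tail U e : basic_open U -> U (Node (arc_tail e)) ->
  exists2 d, 0 < d & forall t : {t : R | 0 < t < 1}, sval t < d -> U (Inner e t).
Proof.
case=> [v eps e0|f a b _ _ _ _|X w eps _ e0|X w h z eps _ _ _|X v w z eps _ _ _ _
  |X w v z eps _ _ _ _] //=.
  by move=> te; exists eps => // t lt; left.
move=> te; exists eps => // t lt.
have [he|nhe] := pselect (end_nodes X w (arc_head e)); first exact: Or31.
by apply: Or32.
Qed.

Lemma basic_open_head U e : basic_open U -> U (Node (arc_head e)) ->
  exists2 d, 0 < d & forall t : {t : R | 0 < t < 1}, 1 - d < sval t -> U (Inner e t).
Proof.
case=> [v eps e0|f a b _ _ _ _|X w eps _ e0|X w h z eps _ _ _|X v w z eps _ _ _ _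
  |X w v z eps _ _ _ _] //=.
  by move=> he; exists eps => // t lt; right.
move=> he; exists eps => // t lt.
have [te|nte] := pselect (end_nodes X w (arc_tail e)); first exact: Or31.
by apply: Or33.
Qed.

(** Continuity of the map from [0,1] onto the closed arc [e]. The minima in the radii keep [z'] away
    from an end of the arc that differs from [z]. *)
Lemma arc_point_near U e z : basic_open U -> 0 <= z <= 1 -> U (arc_point e z) ->
  exists2 d, 0 < d & forall z', 0 <= z' <= 1 -> `|z' - z| < d -> U (arc_point e z').
Proof.
move=> bU z01; case: (arc_pointP e z01) => [->|->|[t <-]].
- rewrite arc_point0 => Ut; have [d d0 dP] := basic_open_tail bU Ut.
  exists (Num.min d 1); first by rewrite lt_min d0 ltr01.
  move=> z' /(arc_pointP e)[->|->|[t <-]];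
    rewrite lt_min !ltr_distl => /andP[/andP[? ?] /andP[? ?]].
  + by rewrite arc_point0.
  + by exfalso; lra.
  + by rewrite arc_point_inner; apply: dP; lra.
- rewrite arc_point1 => Uh; have [d d0 dP] := basic_open_head bU Uh.
  exists (Num.min d 1); first by rewrite lt_min d0 ltr01.
  move=> z' /(arc_pointP e)[->|->|[t <-]];
    rewrite lt_min !ltr_distl => /andP[/andP[? ?] /andP[? ?]].
  + by exfalso; lra.
  + by rewrite arc_point1.
  + by rewrite arc_point_inner; apply: dP; lra.
- rewrite arc_point_inner => Ui; have [d d0 dP] := basic_open_inner bU Ui.
  have /andP[t0 t1] := valP t.
  exists (Num.min d (Num.min (sval t) (1 - sval t))); first by rewrite !lt_min d0 subr_gt0 t0.
  move=> z' /(arc_pointP e)[->|->|[t' <-]];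
    rewrite !lt_min => /and3P[zd]; rewrite !ltr_distl => /andP[? ?] /andP[? ?].
  + by exfalso; lra.
  + by exfalso; lra.
  + by rewrite arc_point_inner; apply: dP.
Qed.

Lemma arc_point_inj e z z' : arc_tail e <> arc_head e -> 0 <= z <= 1 -> 0 <= z' <= 1 ->
  arc_point e z = arc_point e z' :> end_space R D -> z = z'.
Proof.
move=> te /(arc_pointP e)[->|->|[t <-]] /(arc_pointP e)[->|->|[t' <-]];
  rewrite ?arc_point0 ?arc_point1 ?arc_point_inner //.
- by case.
- by case=> /esym.
- by case=> ->.
Qed.

Lemma arc_tail_head e : tournament D -> arc_tail e <> arc_head e.
Proof.
move=> Dt; case: e => [[u|w] [v|h] /=] // a [E].
  by move: a; rewrite E tournament_irr.
by case: a => /(_ E).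
Qed.

Lemma end_ends_comp (X : set D) (w h : ends D) : finite_set X -> end_ends X w h ->
  end_comp X h = end_comp X w.
Proof.
move=> fX [r hr rw]; apply: end_comp_eq hr _ => //; first by have [] := end_compP w fX.
by exists 0%N => n _; apply: rw; exists n.
Qed.

End EndSpace.

(** * The Hamilton circle *)

Section Circle.
Local Open Scope ring_scope.
Variables (R : realType) (D : digraph) (Dt : tournament D) (v0 : D).
Local Notation timed := ((set D * bool) * (R * R))%type.
Variable st : nat -> seq timed.
Hypothesis stP : resolution v0 st.
Implicit Types (i j k : timed) (s t a b : R) (v : D) (w : ends D) (p q : node D).

Let stS n : stage v0 (st n).
Proof. by have [] := stP. Qed.

Let X n : set D := vertices (st n).
Let L n := line v0 (st n).
Let at_ i t := lo i <= t <= hi i.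

Lemma node_at_vertex_unique t v p : node_at v0 st t (inl v) ->
  node_at v0 st t p -> p = inl v.
Proof.
move=> [m [i iL [iv il ih]]]; case: p => [u|w].
  move=> [m' [i' i'L [i'u i'l i'h]]].
  have [j jL [jv jl jh]] := node_at_vertex_persists stP (leq_maxl m m') iL iv il ih.
  have [j' j'L [j'v j'l j'h]] := node_at_vertex_persists stP (leq_maxr m m') i'L i'u i'l i'h.
  have jt : at_ j t by rewrite /at_ jl jh lexx.
  have j't : at_ j' t by rewrite /at_ j'l j'h lexx.
  have ej := line_disjoint (stS _) jL j'L jt j't.
  by congr inl; have : [set v] u by rewrite -jv ej j'v.
move=> /(_ m)[k kL [kt nsk _]].
have jt : at_ i t by rewrite /at_ il ih lexx.
by case: nsk; exists v; rewrite (line_disjoint (stS m) kL iL kt jt).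
Qed.

Lemma node_inside n i Y w s p : i \in L n -> ~ single (iset i) -> finite_set Y ->
  Y `<=` X n -> end_comp (X n) w = iset i -> at_ i s -> node_at v0 st s p ->
  end_nodes Y w p.
Proof.
move=> iL nsi fY YX ew is_ sp.
have sub : iset i `<=` end_comp Y w.
  by rewrite -ew; apply: end_comp_sub => //; exact: X_finite.
case: p sp => [u [m [j jL [ju jl jh]]]|h sh] /=.
  have [j' j'L [j'u j'l j'h]] := node_at_vertex_persists stP (leq_maxr n m) jL ju jl jh.
  have [k kL jk] := line_below stP (leq_maxl n m) j'L.
  have j's : at_ j' s by rewrite /at_ j'l j'h lexx.
  have ki := line_disjoint (stS n) kL iL (below_at jk j's) is_.
  by apply: sub; rewrite -ki; have [+ _ _] := jk; apply; rewrite j'u.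
have [k kL [ks _ ek]] := sh n.
have ki := line_disjoint (stS n) kL iL ks is_.
apply: end_ends_tail => //; have [r [_ hr]] := end_ray h; exists r => //.
apply: has_tail_in_sub sub _; rewrite -ki -ek.
by have [_] := end_compP h (X_finite st n); apply.
Qed.

(** The path is handled through its defining properties alone: nodes at node times, and constant
    speed along the arc of each gap. The functions are chosen in the final theorem. *)
Variable nd : R -> node D.
Hypothesis ndP : forall t, node_time v0 st t -> node_at v0 st t (nd t).
Variable alpha : R -> end_space R D.
Hypothesis alphaP : forall t, 0 <= t <= 1 ->
  (node_time v0 st t /\ alpha t = Node (nd t)) \/
  exists a b (e : darc D), [/\ gap v0 st a b, a < t < b, arc_tail e = nd a,
    arc_head e = nd b & alpha t = arc_point e ((t - a) / (b - a))].

Lemma alpha_node t : node_time v0 st t -> alpha t = Node (nd t).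
Proof.
move=> tT; case: (alphaP (node_time_bounds stP tT)) => [[_ //]|[a [b [e [[_ _ _ gab]]]]]].
by move=> /gab.
Qed.

Lemma gap_darc a b : gap v0 st a b -> exists e : darc D,
  arc_tail e = nd a /\ arc_head e = nd b.
Proof.
move=> gab; have [aT bT _ _] := gab.
by exists (DArc (gap_arc stP gab (ndP aT) (ndP bT))).
Qed.

Lemma gap_bounds a b : gap v0 st a b -> [/\ 0 <= a, a < b & b <= 1].
Proof.
by move=> [/(node_time_bounds stP) ? /(node_time_bounds stP) ? ? _]; split; lra.
Qed.

Lemma alpha_gap a b (e : darc D) t : gap v0 st a b -> arc_tail e = nd a ->
  arc_head e = nd b -> a <= t <= b -> alpha t = arc_point e ((t - a) / (b - a)).
Proof.
move=> gab ea eb /andP[lat ltb]; have [aT bT ab nab] := gab.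
have [a0 _ b1] := gap_bounds gab.
have [->|nta] := eqVneq t a.
  by rewrite subrr mul0r arc_point0 ea alpha_node.
have [->|ntb] := eqVneq t b.
  by rewrite divff ?arc_point1 ?eb ?alpha_node // subr_eq0 gt_eqF.
have tab : a < t < b by rewrite !lt_neqAle eq_sym nta ntb lat ltb.
have t01 : 0 <= t <= 1 by lra.
case: (alphaP t01) => [[tT _]|[a' [b' [e' [gab' tab' ea' eb' ->]]]]].
  by case: (nab t tab).
have [ea_ eb_] := gap_unique gab gab' tab tab'.
by rewrite -ea_ -eb_ (darc_inj (e := e) (f := e')) // ?ea ?eb ?ea' ?eb' ?ea_ ?eb_.
Qed.

Lemma alpha_cases t : 0 <= t <= 1 ->
  (node_time v0 st t /\ alpha t = Node (nd t)) \/
  exists a b (e : darc D) (z : {t : R | 0 < t < 1}),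
    [/\ gap v0 st a b, a < t < b, arc_tail e = nd a /\ arc_head e = nd b,
     alpha t = Inner e z & sval z = (t - a) / (b - a)].
Proof.
move=> t01; case: (alphaP t01) => [|[a [b [e [gab tab ea eb ->]]]]]; first by left.
right; exists a, b, e.
have z01 : 0 < (t - a) / (b - a) < 1.
  by rewrite divr_gt0 ?ltr_pdivrMr ?mul1r; lra.
by exists (exist (fun x : R => 0 < x < 1) _ z01); split=> //; rewrite -arc_point_inner.
Qed.

Lemma alpha_inj s t : 0 <= s < 1 -> 0 <= t < 1 -> alpha s = alpha t -> s = t.
Proof.
move=> s01 t01; have s01' : 0 <= s <= 1 by lra.
have t01' : 0 <= t <= 1 by lra.
case: (alpha_cases s01') => [[sT ->]|[a [b [e [z [gab sab [ea eb] -> ez]]]]]];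
case: (alpha_cases t01') => [[tT ->]|[a' [b' [e' [z' [gab' tab' [ea' eb'] -> ez']]]]]] //.
  case=> E; apply: (node_at_inj stP) (ndP sT) _; [lra | lra |].
  by rewrite E; exact: ndP.
case=> ee' zz'; have [aT bT ab nab] := gab; have [a'T b'T ab' nab'] := gab'.
have [_ _ b1] := gap_bounds gab; have [_ _ b'1] := gap_bounds gab'.
have eaa : a = a'.
  apply: (node_at_inj stP) (ndP aT) _; [lra | lra |].
  by rewrite -ea ee' ea'; exact: ndP.
(* Comparing heads would not do here: [b] may be 1, where [node_at_inj] does not apply. Two gaps
   with the same left end must agree. *)
have ebb : b = b'.
  case: (ltgtP b b') => // lt; first by case: (nab' b) => //; lra.
  by case: (nab b') => //; lra.
have : (s - a) / (b - a) = (t - a) / (b - a) by rewrite -ez zz' ez' -eaa -ebb.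
have d0 : b - a != 0 by rewrite subr_eq0 gt_eqF.
by move/(congr1 (fun x => x * (b - a))); rewrite !divfK //; lra.
Qed.

Lemma node_time0 : node_time v0 st 0.
Proof. exact: (node_time_lo stP (n := 0%N) (mem_head _ _)). Qed.

Lemma last_in_line n : last_item R v0 \in L n.
Proof. by rewrite inE (line_last (stS n)) orbT. Qed.

Lemma node_time1 : node_time v0 st 1.
Proof. exact: (node_time_lo stP (last_in_line 0)). Qed.

Lemma alpha_closed : alpha 0 = alpha 1.
Proof.
rewrite (alpha_node node_time0) (alpha_node node_time1).
have n0 : node_at v0 st 0 (inl v0) by exists 0%N, (start_item R v0); rewrite ?mem_head.
have n1 : node_at v0 st 1 (inl v0).
  by exists 0%N, (last_item R v0); [exact: last_in_line | ].
rewrite (node_at_vertex_unique n0 (ndP node_time0)).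
by rewrite (node_at_vertex_unique n1 (ndP node_time1)).
Qed.

Lemma alpha_vertex v : exists2 t, 0 <= t <= 1 & alpha t = Node (inl v).
Proof.
have [_ _ /(_ v)[n [_ /mapP[i is_ ->] iv]] _] := stP.
have iL : i \in L n by rewrite inE is_ orbT.
have [_ [_ eqs]] := line_well_timed (stS n) iL.
have lT := node_time_lo stP iL.
exists (lo i); first exact: (node_time_bounds stP).
rewrite alpha_node // (node_at_vertex_unique (v := v) _ (ndP lT)) //.
by exists n, i => //; split=> //; rewrite eqs //; exists v.
Qed.

(** The end points of an item are node times, so a gap that meets its interval lies within it. The
    arc of this gap then has both ends inside the neighbourhood and belongs to it entirely. *)
Lemma alpha_inside n i Y w eps s : i \in L n -> ~ single (iset i) -> finite_set Y ->
  Y `<=` X n -> end_comp (X n) w = iset i -> at_ i s -> 0 < eps ->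
  end_nbhd Y w eps (alpha s).
Proof.
move=> iL nsi fY YX ew is_ eps0; have [i0 il i1] := line_bounds (stS n) iL.
have s01 : 0 <= s <= 1 by move: is_; rewrite /at_; lra.
have inside u : node_time v0 st u -> at_ i u -> end_nodes Y w (nd u).
  by move=> uT iu; exact: (node_inside iL nsi fY YX ew iu (ndP uT)).
case: (alpha_cases s01) => [[sT ->]|[a [b [e [z [gab sab [ea eb] -> _]]]]]] /=.
  exact: inside.
have [aT bT _ nab] := gab.
have al : lo i <= a.
  rewrite leNgt; apply/negP => lt; apply: (nab (lo i)) (node_time_lo stP iL).
  by move: is_; rewrite /at_; lra.
have bh : b <= hi i.
  rewrite leNgt; apply/negP => lt; apply: (nab (hi i)) (node_time_hi stP iL).
  by move: is_; rewrite /at_; lra.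
by apply: Or31; rewrite ea eb; split; apply: inside => //; rewrite /at_; lra.
Qed.

Lemma alpha_near_gap a b U t : gap v0 st a b -> basic_open U -> a <= t <= b ->
  U (alpha t) ->
  exists2 d, 0 < d & forall s, a <= s <= b -> `|s - t| < d -> U (alpha s).
Proof.
move=> gab bU tab; have [e [ea eb]] := gap_darc gab; have [_ ab _] := gap_bounds gab.
have scale u : a <= u <= b -> 0 <= (u - a) / (b - a) <= 1.
  by move=> uab; rewrite divr_ge0 ?ler_pdivrMr ?mul1r; lra.
rewrite (alpha_gap gab ea eb tab) => Ut.
have [d d0 dP] := arc_point_near bU (scale t tab) Ut.
exists (d * (b - a)); first by rewrite mulr_gt0 // subr_gt0.
move=> s sab sd; rewrite (alpha_gap gab ea eb sab); apply: dP; first exact: scale.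
have ba0 : 0 < b - a by rewrite subr_gt0.
rewrite -mulrBl (_ : s - a - (t - a) = s - t); last by lra.
by rewrite normrM [`|(b - a)^-1|]gtr0_norm ?invr_gt0 // ltr_pdivrMr.
Qed.
(** For a vertex the item is the single time [t]. For an end the stage is taken so late that it has
    deleted the finite set defining [U]. *)
Lemma alpha_near_item t U : basic_open U -> node_time v0 st t -> U (alpha t) ->
  exists n, exists2 i, i \in L n & at_ i t /\ forall s, at_ i s -> U (alpha s).
Proof.
move=> bU tT Ut; have := ndP tT; have := Ut; rewrite (alpha_node tT).
case E : (nd t) => [v|h] Ut' => [[n [i iL [iv il ih]]]|th].
  exists n, i => //; rewrite /at_ il ih lexx; split=> // s ts.
  by rewrite (_ : s = t) //; lra.
(* Among the basic sets only those of the form [end_nbhd] contain an end. *)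
case: bU Ut' {Ut} => [||Y w eps fY eps0|||] //= Uh.
have [n YX] := X_exhaust stP fY; have [i iL [it nsi ei]] := th n.
exists n, i => //; split=> // s is_.
(* [U] may be centred at another end [w]; as [h] belongs to [end_ends Y w], both ends have the same
   component and so the same neighbourhood. *)
have -> : end_nbhd Y w eps = end_nbhd Y h eps :> set (end_space R D).
  by rewrite /end_nbhd /end_nodes /end_ends (end_ends_comp fY Uh).
exact: (alpha_inside iL nsi fY YX ei is_ eps0).
Qed.

(** Either the item at [t] extends to the right of [t] and lies in [U] as a whole, or a gap begins
    or continues at [t], where continuity along its arc is enough, or [t] is 1. *)
Lemma alpha_near_right t U : basic_open U -> 0 <= t <= 1 -> U (alpha t) ->
  exists2 d, 0 < d & forall s, t <= s -> s <= 1 -> s - t < d -> U (alpha s).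
Proof.
move=> bU t01 Ut.
have from_gap a b : gap v0 st a b -> a <= t < b ->
    exists2 d, 0 < d & forall s, t <= s -> s <= 1 -> s - t < d -> U (alpha s).
  move=> gab tab; have tab' : a <= t <= b by lra.
  have [d d0 dP] := alpha_near_gap gab bU tab' Ut.
  exists (Num.min d (b - t)); first by rewrite lt_min d0; lra.
  move=> s ts s1; rewrite lt_min => /andP[sd sb]; apply: dP; first by lra.
  by rewrite ger0_norm; lra.
have [tT|ntT] := pselect (node_time v0 st t); last first.
  by have [a [b [gab tab]]] := gap_exists stP t01 ntT; apply: from_gap gab _; lra.
have [n [i iL [it iU]]] := alpha_near_item bU tT Ut.
have [tlt|tge] := ltP t (hi i).
  exists (hi i - t); first by lra.
  by move=> s ts s1 sd; apply: iU; move: it; rewrite /at_; lra.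
have ti : hi i = t by move: it; rewrite /at_; lra.
have [t1|t1] := ltP t 1; last first.
  by exists 1 => // s ts s1 _; rewrite (_ : s = t) //; lra.
rewrite -ti in t1 from_gap *; have [b gb] := gap_right stP iL t1.
by rewrite -ti in Ut; apply: (from_gap _ _ gb); have [_ ? _] := gap_bounds gb; lra.
Qed.

Lemma alpha_near_left t U : basic_open U -> 0 <= t <= 1 -> U (alpha t) ->
  exists2 d, 0 < d & forall s, s <= t -> 0 <= s -> t - s < d -> U (alpha s).
Proof.
move=> bU t01 Ut.
have from_gap a b : gap v0 st a b -> a < t <= b ->
    exists2 d, 0 < d & forall s, s <= t -> 0 <= s -> t - s < d -> U (alpha s).
  move=> gab tab; have tab' : a <= t <= b by lra.
  have [d d0 dP] := alpha_near_gap gab bU tab' Ut.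
  exists (Num.min d (t - a)); first by rewrite lt_min d0; lra.
  move=> s ts s1; rewrite lt_min => /andP[sd sb]; apply: dP; first by lra.
  by rewrite ler0_norm; lra.
have [tT|ntT] := pselect (node_time v0 st t); last first.
  by have [a [b [gab tab]]] := gap_exists stP t01 ntT; apply: from_gap gab _; lra.
have [n [i iL [it iU]]] := alpha_near_item bU tT Ut.
have [tlt|tge] := ltP (lo i) t.
  exists (t - lo i); first by lra.
  by move=> s ts s1 sd; apply: iU; move: it; rewrite /at_; lra.
have ti : lo i = t by move: it; rewrite /at_; lra.
have [t1|t1] := ltP 0 t; last first.
  by exists 1 => // s ts s1 _; rewrite (_ : s = t) //; lra.
rewrite -ti in t1 from_gap *; have [a ga] := gap_left stP iL t1.
by apply: (from_gap _ _ ga); have [_ ? _] := gap_bounds ga; lra.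
Qed.

Lemma alpha_continuous : {within `[0, 1], continuous alpha}.
Proof.
apply/subspace_continuousP => t; rewrite /= in_itv /= => t01.
apply: cvg_end_space => U bU Ut.
have [d d0 dP] := alpha_near_right bU t01 Ut; have [d' d'0 d'P] := alpha_near_left bU t01 Ut.
have near_t : \forall s \near t, 0 <= s <= 1 -> U (alpha s).
  near=> s => s01; have [ts|st_] := leP t s.
    apply: dP => //; first by lra.
    rewrite -[s - t]ger0_norm; last by lra.
    by rewrite distrC; near: s; exact: cvgr_dist_lt.
  apply: d'P => //; [by lra | by lra |].
  rewrite -[t - s]ger0_norm; last by lra.
  by near: s; exact: cvgr_dist_lt.
by apply: filterS near_t => s H; rewrite /= in_itv.
Unshelve. all: by end_near. Qed.

(** Inner points of [e] are met only inside the gap, and its two ends only at [a] and [b], up to the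
    double visit of [v0], which [0 < r < 1] excludes. *)
Lemma alpha_on_arc a b (e : darc D) r : gap v0 st a b -> arc_tail e = nd a ->
  arc_head e = nd b -> 0 < r < 1 -> (arc_point e @` `[0, 1]) (alpha r) -> a <= r <= b.
Proof.
move=> gab ea eb r01 [c /=]; rewrite in_itv /= => c01 ec.
have r01' : 0 <= r <= 1 by lra.
have [aT bT ab _] := gab; have [a0 _ b1] := gap_bounds gab.
move: (arc_pointP e c01) ec.
case: (alpha_cases r01') => [[rT ->]|[a' [b' [e' [z [gab' rab [ea' eb'] -> _]]]]]].
  case=> [->|->|[c' <-]]; rewrite ?arc_point0 ?arc_point1 ?arc_point_inner // => -[E].
    have -> : r = a; last by lra.
    apply: (node_at_inj stP) (ndP rT) _; [lra | lra |].
    by rewrite -E ea; exact: ndP.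
  have [b_lt1|b_ge1] := ltP b 1.
    have -> : r = b; last by lra.
    apply: (node_at_inj stP) (ndP rT) _; [lra | lra |].
    by rewrite -E eb; exact: ndP.
  (* Here the head of [e] is [v0], whose only visit before time 1 is at time 0. *)
  have b_1 : b = 1 by lra.
  have n0 : node_at v0 st 0 (inl v0) by exists 0%N, (start_item R v0); rewrite ?mem_head.
  have n1 : node_at v0 st 1 (inl v0).
    by exists 0%N, (last_item R v0); [exact: last_in_line | ].
  suff : r = 0 by lra.
  apply: (node_at_inj stP) (ndP rT) _; [lra | lra |].
  by rewrite -E eb b_1 (node_at_vertex_unique n1 (ndP node_time1)).
case=> [->|->|[c' <-]]; rewrite ?arc_point0 ?arc_point1 ?arc_point_inner // => -[E _].
have [a'T _ _ nab'] := gab'; have [_ _ b'1] := gap_bounds gab'.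
have eaa : a' = a.
  apply: (node_at_inj stP) (ndP a'T) _; [lra | lra |].
  by rewrite -ea' -E ea; exact: ndP.
have [|lt] := leP r b; first by lra.
by case: (nab' b) => //; lra.
Qed.

(** Some time between [s] and [t] lies in a gap, since a closed arc has only two nodes. The arc of
    that gap is [e], the whole of [[s], [t]] lies in the closed gap, and there the coordinate is an
    increasing linear function of time. *)
Lemma alpha_directed s t (e : darc D) : 0 <= s -> s < t -> t <= 1 ->
  alpha @` `[s, t] `<=` arc_point e @` `[0, 1] ->
  forall x y : R, x \in `[0, 1] -> y \in `[0, 1] ->
  alpha s = arc_point e x -> alpha t = arc_point e y -> x <= y.
Proof.
move=> s0 st_ t1 sub x y; rewrite !in_itv /= => x01 y01 ax ay.
have on_arc r : s <= r <= t -> (arc_point e @` `[0, 1]) (alpha r).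
  by move=> rst; apply: sub; exists r => //=; rewrite in_itv.
have [u ust nuT] : exists2 u, s < u < t & ~ node_time v0 st u.
  apply: contrapT => none.
  have all_nodes r : s < r < t -> node_time v0 st r.
    by move=> rst; apply: contrapT => nrT; apply: none; exists r.
  have ends_only r : s < r < t -> nd r = arc_tail e \/ nd r = arc_head e.
    move=> rst; have [|c] := on_arc r; first by lra.
    rewrite /= in_itv /= alpha_node; last exact: all_nodes.
    move=> /(arc_pointP e)[->|->|[c' <-]];
      rewrite ?arc_point0 ?arc_point1 ?arc_point_inner // => -[<-]; by [left|right].
  have same r r' p : s < r < t -> s < r' < t -> nd r = p -> nd r' = p -> r = r'.
    move=> rst r'st rp r'p; apply: (node_at_inj stP) (ndP (all_nodes r rst)) _; [lra|lra|].
    by rewrite rp -r'p; apply: ndP; exact: all_nodes.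
  (* Three distinct inner times would have to share the two ends of [e]. *)
  pose r1 := s + (t - s) / 4%:R; pose r2 := s + (t - s) / 2%:R.
  pose r3 := s + (t - s) * 3%:R / 4%:R.
  have h1 : s < r1 < t by rewrite /r1; lra.
  have h2 : s < r2 < t by rewrite /r2; lra.
  have h3 : s < r3 < t by rewrite /r3; lra.
  have n12 : r1 <> r2 by rewrite /r1 /r2; lra.
  have n13 : r1 <> r3 by rewrite /r1 /r3; lra.
  have n23 : r2 <> r3 by rewrite /r2 /r3; lra.
  case: (ends_only r1 h1) => e1; case: (ends_only r2 h2) => e2;
    case: (ends_only r3 h3) => e3;
    by [apply: n12; exact: same e1 e2 | apply: n13; exact: same e1 e3
      | apply: n23; exact: same e2 e3].
have u01 : 0 <= u <= 1 by lra.
have [[//]|[a [b [e' [z [gab uab [ea eb] au _]]]]]] := alpha_cases u01.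
have ee' : e = e'.
  have [|c] := on_arc u; first by lra.
  rewrite /= in_itv /= au => /(arc_pointP e)[->|->|[c' <-]];
    by rewrite ?arc_point0 ?arc_point1 ?arc_point_inner // => -[].
rewrite -ee' in ea eb; have [_ ab _] := gap_bounds gab.
(* [alpha_on_arc] does not cover time 0, so it is applied to a midpoint instead of [s]; likewise for
   [t] below. *)
have sa : a <= s.
  rewrite leNgt; apply/negP => sa; pose r := (s + a) / 2%:R.
  have rsa : s < r < a by rewrite /r; lra.
  have : a <= r <= b by apply: (alpha_on_arc gab ea eb); [lra | apply: on_arc; lra].
  lra.
have tb : t <= b.
  rewrite leNgt; apply/negP => bt; pose r := (b + t) / 2%:R.
  have rbt : b < r < t by rewrite /r; lra.
  have : a <= r <= b by apply: (alpha_on_arc gab ea eb); [lra | apply: on_arc; lra].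
  lra.
have coord r c : 0 <= c <= 1 -> a <= r <= b -> alpha r = arc_point e c ->
    c = (r - a) / (b - a).
  move=> c01 rab; rewrite (alpha_gap gab ea eb rab) => E.
  apply: (arc_point_inj (arc_tail_head (e := e) Dt) c01 _ (esym E)).
  by rewrite divr_ge0 ?ler_pdivrMr ?mul1r; lra.
rewrite (coord s x x01 _ ax); last by lra.
rewrite (coord t y y01 _ ay); last by lra.
by rewrite ler_pM2r ?invr_gt0; lra.
Qed.

End Circle.

Theorem theorem2 (R : realType) (D : digraph)
    (Dcountable : [set: D] #= [set: nat])
    (Dtournament : tournament D)
    (Dstrong : strongly_connected [set: D])
    (Dsolid : solid D) :
  exists alpha : R -> end_space R D, hamilton_circle alpha.
Proof.
have [v0 [st stP]] := resolution_exists R Dtournament Dsolid Dstrong Dcountable.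
have /choice[nd ndP] : forall t, exists p, node_time v0 st t -> node_at v0 st t p.
  move=> t; have [/(node_time_exists stP)[p tp]|ntT] := pselect (node_time v0 st t).
    by exists p.
  by exists (inl v0).
have /choice[alpha alphaP] : forall t : R, exists x : end_space R D, (0 <= t <= 1)%R ->
    (node_time v0 st t /\ x = Node (nd t)) \/
    exists a b (e : darc D), [/\ gap v0 st a b, (a < t < b)%R, arc_tail e = nd a,
      arc_head e = nd b & x = arc_point e ((t - a) / (b - a))%R].
  move=> t; have [tT|ntT] := pselect (node_time v0 st t).
    by exists (Node (nd t)) => _; left.
  (* Outside [0,1] the value is arbitrary. *)
  have [t01|nt01] := pselect (is_true (0 <= t <= 1)%R); last by exists (Node (inl v0)).
  have [a [b [gab tab]]] := gap_exists stP t01 ntT; have [e [ea eb]] := gap_darc stP ndP gab.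
  by exists (arc_point e ((t - a) / (b - a))%R) => _; right; exists a, b, e.
exists alpha; split; first split.
- exact: (alpha_continuous stP ndP alphaP).
- exact: (alpha_directed Dtournament stP ndP alphaP).
- exact: (alpha_closed stP ndP alphaP).
- move=> s t; rewrite !in_itv /=; exact: (alpha_inj stP ndP alphaP).
- move=> v; have [t t01 tv] := alpha_vertex stP ndP alphaP v.
  by exists t; rewrite ?in_itv.
Qed.
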